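(* Let $k=k(n)\ge2$ and $\ell=\ell(n)\ge 2$ satisfy $\log k\,\log\ell=o(\log n)$ as $n\to\infty$. Then there exists an estimator $Q_{X_{n+1}|X^n}$, computable in time polynomial in $n$, such that $$\mathrm{Risk}\big(Q_{X_{n+1}|X^n};\mathcal{P}^{\mathsf{HMM}}_n(k,\ell)\big)=O\left(\frac{\log k\,\log\ell}{\log n}\right).$$
   Context: Notation: $[k]=\{1,\dots,k\}$, $X^n=(X_1,\dots,X_n)$. Hidden Markov model (HMM): $\{Z_t\}_{t\ge1}$ is a stationary Markov chain on $[k]$ with a $k\times k$ row-stochastic transition matrix $M$; $T$ is a $k\times\ell$ row-stochastic emission matrix; $\{X_t\}_{t\ge 1}$ is $[\ell]$-valued with $P_{X^m|Z^m}(x^m|z^m)=\prod_{t=1}^m T(x_t|z_t)$ for every $m$. $\mathcal{P}^{\mathsf{HMM}}_n(k,\ell)$ is the collection of all joint distributions of $X^{n+1}=(X_1,\dots,X_{n+1})$ arising this way. An estimator is a conditional distribution $Q_{X_{n+1}|X^n}$. Its prediction risk over a class $\mathcal{P}_{n+1}$ of joint laws of $X^{n+1}$ is $$\mathrm{Risk}(Q_{X_{n+1}|X^n};\mathcal{P}_{n+1})=\sup_{P\in\mathcal{P}_{n+1}}\mathbb{E}_{P}\big[\mathrm{KL}(P_{X_{n+1}|X^n}\,\|\,Q_{X_{n+1}|X^n})\big],$$ where $\mathrm{KL}$ is the Kullback-Leibler divergence. *)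

(* Defs.v *)
From HB Require Import structures.
From mathcomp Require Import all_boot all_order all_algebra.
From mathcomp Require Import all_classical all_reals all_analysis.

Set Implicit Arguments.
Unset Strict Implicit.
Unset Printing Implicit Defensive.

Import Order.TTheory GRing.Theory Num.Theory.
Import numFieldNormedType.Exports.

Local Open Scope classical_set_scope.
Local Open Scope ring_scope.

(* The alphabets {1, .., k} and {1, .., l} are represented by 'I_k and 'I_l,
   and a law on a finite set by its probability mass function. *)

Definition is_dist (R : realType) (A : finType) (p : A -> R) : Prop :=
  (forall a, 0 <= p a) /\ \sum_a p a = 1.

Definition row_stochastic (R : realType) (m n : nat) (A : 'M[R]_(m, n)) : Prop :=
  forall i, is_dist (A i).

Definition stationary (R : realType) (k : nat)
    (pi : 'rV[R]_k) (M : 'M[R]_k) : Prop :=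
  is_dist (pi ord0) /\ pi *m M = pi.

(* P(Z_1 = z_1, .., Z_(n+1) = z_(n+1)) for the chain with initial law pi. *)
Definition markov_law (R : realType) (k n : nat) (pi : 'rV[R]_k) (M : 'M[R]_k)
    (z : n.+1.-tuple 'I_k) : R :=
  pi ord0 (thead z) *
  \prod_(t < n) M (tnth z (widen_ord (leqnSn n) t)) (tnth z (lift ord0 t)).

Definition emission_law (R : realType) (k l m : nat) (T : 'M[R]_(k, l))
    (z : m.-tuple 'I_k) (x : m.-tuple 'I_l) : R :=
  \prod_(t < m) T (tnth z t) (tnth x t).

Definition hmm_law (R : realType) (k l n : nat) (pi : 'rV[R]_k) (M : 'M[R]_k)
    (T : 'M[R]_(k, l)) (x : n.+1.-tuple 'I_l) : R :=
  \sum_(z : n.+1.-tuple 'I_k) markov_law pi M z * emission_law T z x.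

(* The laws are those of X^(n+1): n observations and the symbol to predict. *)
Definition hmm_class (R : realType) (k l n : nat) :
    set (n.+1.-tuple 'I_l -> R) :=
  [set P | exists (pi : 'rV[R]_k) (M : 'M[R]_k) (T : 'M[R]_(k, l)),
     [/\ row_stochastic M, row_stochastic T, stationary pi M
       & P = hmm_law pi M T]].

Definition is_estimator (R : realType) (l n : nat)
    (Q : n.-tuple 'I_l -> 'I_l -> R) : Prop :=
  forall x, is_dist (Q x).

(* The summand at p a = 0 vanishes, whatever the value of q a. *)
Definition KL (R : realType) (A : finType) (p q : A -> R) : \bar R :=
  if [forall a, (q a == 0) ==> (p a == 0)]
  then (\sum_a p a * ln (p a / q a))%:E else +oo%E.

Definition past_law (R : realType) (l n : nat) (P : n.+1.-tuple 'I_l -> R)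
    (x : n.-tuple 'I_l) : R :=
  \sum_a P (rcons_tuple x a).

Definition cond_law (R : realType) (l n : nat) (P : n.+1.-tuple 'I_l -> R)
    (x : n.-tuple 'I_l) (a : 'I_l) : R :=
  P (rcons_tuple x a) / past_law P x.

(* Pasts x of probability 0 contribute 0, since 0 * y = 0 in \bar R even for
   y = +oo; so the junk value of cond_law there is irrelevant. *)
Definition expected_KL (R : realType) (l n : nat) (P : n.+1.-tuple 'I_l -> R)
    (Q : n.-tuple 'I_l -> 'I_l -> R) : \bar R :=
  (\sum_(x : n.-tuple 'I_l) (past_law P x)%:E * KL (cond_law P x) (Q x))%E.

Definition risk (R : realType) (l n : nat) (Q : n.-tuple 'I_l -> 'I_l -> R)
    (C : set (n.+1.-tuple 'I_l -> R)) : \bar R :=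
  ereal_sup [set expected_KL P Q | P in C].

(* The machine model is the random access machine with addition, truncated
   subtraction, indirect addressing and structured control, in the unit-cost
   measure.  There is no multiplication, so t steps lengthen (in binary) the
   largest number in memory by at most t bits plus a constant; hence this
   unit-cost measure is polynomially related to Turing machine time. *)

Definition memory := nat -> nat.

Definition upd (s : memory) (i v : nat) : memory :=
  fun j => if j == i then v else s j.

Inductive prog : Type :=
| Const of nat & nat
| Add of nat & nat & nat
| Sub of nat & nat & nat
| Read of nat & nat
| Write of nat & nat
| Seq of prog & prog
| Ifz of nat & prog & prog
| While of nat & prog.

(* In exec p s t s', the cost t counts elementary instructions and tests. *)
Inductive exec : prog -> memory -> nat -> memory -> Prop :=
| exec_const i c s : exec (Const i c) s 1 (upd s i c)
| exec_add i j h s : exec (Add i j h) s 1 (upd s i (s j + s h)%N)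
| exec_sub i j h s : exec (Sub i j h) s 1 (upd s i (s j - s h)%N)
| exec_read i j s : exec (Read i j) s 1 (upd s i (s (s j)))
| exec_write i j s : exec (Write i j) s 1 (upd s (s i) (s j))
| exec_seq p q s s' s'' t t' :
    exec p s t s' -> exec q s' t' s'' -> exec (Seq p q) s (t + t')%N s''
| exec_ifz_true i p q s s' t :
    s i = 0%N -> exec p s t s' -> exec (Ifz i p q) s t.+1 s'
| exec_ifz_false i p q s s' t :
    s i <> 0%N -> exec q s t s' -> exec (Ifz i p q) s t.+1 s'
| exec_while_stop i p s : s i = 0%N -> exec (While i p) s 1 s
| exec_while_step i p s s' s'' t t' :
    s i <> 0%N -> exec p s t s' -> exec (While i p) s' t' s'' ->
    exec (While i p) s (t + t').+1 s''.

(* The odd cells 1, 3, 5, .. hold x and the even cells 0, 2, 4 hold n, k, l;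
   all other cells hold 0.  The even cells left are free as registers. *)
Definition input (k l n : nat) (x : n.-tuple 'I_l) : memory :=
  fun i => if odd i then nth 0%N (map (@nat_of_ord l) x) i./2
           else nth 0%N [:: n; k; l] i./2.

(* Cell 0 holds a common denominator, the odd cells 1, 3, 5, .. the
   numerators of the values of q. *)
Definition outputs (R : realType) (l : nat) (s : memory) (q : 'I_l -> R) : Prop :=
  s 0%N <> 0%N /\
  forall a : 'I_l, q a = (s (val a).*2.+1)%:R / (s 0%N)%:R.

(* A single program serves all n; it is given n, k n, l n and x^n, and it
   prints the whole probability vector Q(. | x^n). *)
Definition polytime_computable (R : realType) (k l : nat -> nat)
    (Q : forall n, n.-tuple 'I_(l n) -> 'I_(l n) -> R) : Prop :=
  exists (p : prog) (c d : nat), forall n (x : n.-tuple 'I_(l n)),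
    exists (t : nat) (s : memory),
      [/\ exec p (input (k n) x) t s, (t <= c * n ^ d + c)%N
        & outputs s (Q n x)].

(* Main.v *)
Require Import Defs.
From HB Require Import structures.
From mathcomp Require Import all_boot all_order all_algebra.
From mathcomp Require Import all_classical all_reals all_analysis.
From mathcomp Require Import zify ring lra.

(** The predictor is an order-m Markov predictor with add-one smoothing,
    averaged over all windows of the past.  For a window that starts at s, let
    q_s(a) = (N_s(a) + 1) / (N_s + l), where N_s counts the positions of the
    window whose preceding m letters agree with the last m letters observed,
    and N_s(a) those positions that in addition carry the letter a; the
    predictor is the mean of the q_s over s = 0, ..., n - m.  Here m is the
    largest integer with l^(2m) <= n (and 0 if n = 0), so that there are at most sqrt n contexts
    and m + 1 > ln n / (2 ln l).

    The logarithmic loss is convex, so the loss of the mean is at most the mean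
    of the losses.  By stationarity the loss of q_s at time n has the same
    expectation as the loss at time n - s of the smoothed predictor that has
    seen the process from its start.  The sum over s is therefore a cumulative
    loss, that is, the logarithm of a product, and the product of the smoothed
    probabilities is within a factor (n + l + 1)^(l * l^m) of what any conditional
    law given m letters assigns to the sequence ([laplace_regret]).  Comparing
    with the conditional law of the process itself gives [redundancy_bound]:
      risk <= h_m - h_n + l^(m+1) ln (n + l + 1) / (n - m + 1),
    where h_j is the entropy of a letter given the j preceding ones.

    The second term is O(1 / ln n) once l^4 <= n.  For the first one, the h_j
    decrease, and for a hidden Markov model the past and the future are
    independent given one hidden state, so their mutual information is at most
    ln k ([mixture_entropy]).  That mutual information is the sum of
    h_j - h_(n+j) over j <= m, hence at least (m + 1) (h_m - h_n)
    ([mixture_cond_entropy]), and h_m - h_n <= ln k / (m + 1), which is at most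
    2 ln k ln l / ln n.

    The probabilities are rationals with common denominator
    (n - m + 1) (n + l)!.  A numerator needs no division: the factorial divided
    by a denominator d is the product of the other factors.  The program that
    computes them consists of loops that count down; it is verified with
    weakest preconditions ([runs]) that carry a bound on the running time. *)

Set Implicit Arguments.
Unset Strict Implicit.
Unset Printing Implicit Defensive.

Import Order.TTheory GRing.Theory Num.Theory.
Import numFieldNormedType.Exports.

Local Open Scope classical_set_scope.
Local Open Scope ring_scope.

(** * Sums over words *)

Section Words.
Variables (V : nmodType) (A : finType).
Implicit Types (F : seq A -> V).

Lemma sum_words0 F : \sum_(s : 0.-tuple A) F s = F [::].
Proof. by rewrite (big_pred1 [tuple]) // => t; apply/esym/eqP; exact: tuple0. Qed.

Lemma sum_tuplesS n (F : n.+1.-tuple A -> V) :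
  \sum_s F s = \sum_a \sum_(s : n.-tuple A) F [tuple of a :: s].
Proof.
rewrite pair_big (reindex (fun q : A * n.-tuple A => [tuple of q.1 :: q.2])) //=.
exists (fun s => (thead s, [tuple of behead s])) => [[a s] _|s _] /=.
  by congr (_, _); exact: val_inj.
by case/tupleP: s => a s; apply: val_inj.
Qed.

Lemma sum_wordsS n F :
  \sum_(s : n.+1.-tuple A) F s = \sum_a \sum_(s : n.-tuple A) F (a :: s).
Proof. exact: sum_tuplesS. Qed.

Lemma sum_words_cat i j F : \sum_(s : (i + j).-tuple A) F s =
  \sum_(u : i.-tuple A) \sum_(v : j.-tuple A) F (u ++ v).
Proof.
elim: i F => [|i IH] F.
  by rewrite (sum_words0 (fun u => \sum_(v : j.-tuple A) F (u ++ v))).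
rewrite addSn sum_wordsS (sum_wordsS _ (fun u => \sum_(v : j.-tuple A) F (u ++ v))).
by apply: eq_bigr => a _; rewrite (IH (fun s => F (a :: s))).
Qed.

Lemma sum_words_rcons n F : \sum_(s : n.+1.-tuple A) F s =
  \sum_(u : n.-tuple A) \sum_a F (rcons u a).
Proof.
rewrite -addn1 sum_words_cat; apply: eq_bigr => u _.
rewrite (sum_wordsS _ (fun v => F (u ++ v))); apply: eq_bigr => a _.
by rewrite (sum_words0 (fun v => F (u ++ a :: v))) cats1.
Qed.

End Words.

(** * Stationary processes and block entropies *)

Lemma ln_le_subr1 (R : realType) (x : R) : 0 < x -> ln x <= x - 1.
Proof. by move=> x0; have := expR_ge1Dx (ln x); rewrite lnK ?posrE //; lra. Qed.

(** A process is given by the probabilities of its words.  Summing out the last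
    letter expresses consistency, summing out the first one stationarity. *)
Record stationary_process (R : realType) (A : finType) (p : seq A -> R) : Prop := {
  process_ge0 : forall s, 0 <= p s;
  process_nil : p [::] = 1;
  process_rcons : forall s, \sum_a p (rcons s a) = p s;
  process_cons : forall s, \sum_a p (a :: s) = p s }.

Section Process.
Variables (R : realType) (A : finType) (p : seq A -> R).
Hypothesis hp : stationary_process p.
Let p_ge0 := process_ge0 hp.

Lemma process_catr j u : \sum_(v : j.-tuple A) p (u ++ v) = p u.
Proof.
elim: j u => [|j IH] u; first by rewrite (sum_words0 (fun v => p (u ++ v))) cats0.
rewrite (sum_wordsS _ (fun v => p (u ++ v))) -[RHS](process_rcons hp).
by apply: eq_bigr => a _; rewrite -IH; apply: eq_bigr => v _; rewrite cat_rcons.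
Qed.

Lemma process_catl i v : \sum_(u : i.-tuple A) p (u ++ v) = p v.
Proof.
elim: i => [|i IH]; first by rewrite (sum_words0 (fun u => p (u ++ v))).
rewrite (sum_wordsS _ (fun u => p (u ++ v))) exchange_big /= -[RHS]IH.
by apply: eq_bigr => u _; exact: (process_cons hp).
Qed.

Lemma process_total n : \sum_(s : n.-tuple A) p s = 1.
Proof. by rewrite (process_catr n [::]) (process_nil hp). Qed.

Lemma process_prefix u v : 0 < p (u ++ v) -> 0 < p u.
Proof.
move=> h; apply: lt_le_trans h _; rewrite -(process_catr (size v) u).
rewrite (bigD1 (in_tuple v)) //= lerDl sumr_ge0 // => i _; exact: p_ge0.
Qed.

Lemma process_suffix u v : 0 < p (u ++ v) -> 0 < p v.
Proof.
move=> h; apply: lt_le_trans h _; rewrite -(process_catl (size u) v).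
rewrite (bigD1 (in_tuple u)) //= lerDl sumr_ge0 // => i _; exact: p_ge0.
Qed.

Definition expect n (F : seq A -> R) := \sum_(s : n.-tuple A) p s * F s.

Lemma expect_take i n F : (i <= n)%N -> expect n (fun s => F (take i s)) = expect i F.
Proof.
move=> /subnKC <-; rewrite /expect.
rewrite (sum_words_cat _ _ (fun s => p s * F (take i s))); apply: eq_bigr => u _.
under eq_bigr do rewrite take_size_cat ?size_tuple //.
by rewrite -mulr_suml process_catr.
Qed.

(** This is where stationarity enters: an expectation does not depend on the
    position of the window that it looks at. *)
Lemma expect_drop i n F : (i <= n)%N ->
  expect n (fun s => F (drop i s)) = expect (n - i) F.
Proof.
move=> /subnKC {1}<-; rewrite /expect.
rewrite (sum_words_cat _ _ (fun s => p s * F (drop i s))) exchange_big /=.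
apply: eq_bigr => v _.
under eq_bigr do rewrite drop_size_cat ?size_tuple //.
by rewrite -mulr_suml process_catl.
Qed.

Lemma expect_le n F G : (forall s, size s = n -> 0 < p s -> F s <= G s) ->
  expect n F <= expect n G.
Proof.
move=> h; apply: ler_sum => s _; have := p_ge0 s; rewrite le_eqVlt => /orP[/eqP<-|ps].
  by rewrite !mul0r.
by rewrite ler_pM2l // h // size_tuple.
Qed.

Lemma expectD n F G : expect n (fun s => F s + G s) = expect n F + expect n G.
Proof. by rewrite -big_split; apply: eq_bigr => s _; rewrite mulrDr. Qed.

Lemma expectB n F G : expect n (fun s => F s - G s) = expect n F - expect n G.
Proof. by rewrite -sumrB; apply: eq_bigr => s _; rewrite mulrBr. Qed.

Lemma expectN n F : expect n (fun s => - F s) = - expect n F.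
Proof. by rewrite -sumrN; apply: eq_bigr => s _; rewrite mulrN. Qed.

Lemma expectZ n c F : expect n (fun s => c * F s) = c * expect n F.
Proof. by rewrite mulr_sumr; apply: eq_bigr => s _; rewrite mulrCA. Qed.

Lemma expect_cst n c : expect n (fun=> c) = c.
Proof. by rewrite /expect -mulr_suml process_total mul1r. Qed.

Lemma expect_sum n I (r : seq I) (P : pred I) (F : I -> seq A -> R) :
  expect n (fun s => \sum_(i <- r | P i) F i s) = \sum_(i <- r | P i) expect n (F i).
Proof. by rewrite /expect; under eq_bigr do rewrite mulr_sumr; rewrite exchange_big. Qed.

(** Gibbs inequality, from ln y <= y - 1 at y = r / p.  All entropy
    inequalities below are instances of it. *)
Lemma gibbs n (r : seq A -> R) : (forall s, 0 <= r s) ->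
  (forall s, size s = n -> 0 < p s -> 0 < r s) ->
  \sum_(s : n.-tuple A) r s <= 1 ->
  expect n (fun s => ln (r s) - ln (p s)) <= 0.
Proof.
move=> r0 rp r1; apply: (@le_trans _ _ (\sum_(s : n.-tuple A) (r s - p s))).
  apply: ler_sum => s _; have := p_ge0 s; rewrite le_eqVlt => /orP[/eqP<-|ps].
    by rewrite mul0r subr0.
  have rs : 0 < r s by rewrite rp ?size_tuple.
  have -> : r s - p s = p s * (r s / p s - 1) by field; rewrite gt_eqF.
  by rewrite ler_pM2l // -ln_div ?posrE // ln_le_subr1 // divr_gt0.
by rewrite sumrB process_total subr_le0.
Qed.

Definition entropy n := expect n (fun s => - ln (p s)).

(** The conditional entropy of a letter given the n preceding ones. *)
Definition cond_entropy n := entropy n.+1 - entropy n.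

Lemma entropy0 : entropy 0 = 0.
Proof.
by rewrite /entropy /expect (sum_words0 (fun s => p s * - ln (p s))) (process_nil hp)
  ln1 oppr0 mulr0.
Qed.

(** Gibbs inequality against the measure that makes the first and the last letter
    conditionally independent given the n letters between them. *)
Lemma cond_entropy_decr n : cond_entropy n.+1 <= cond_entropy n.
Proof.
pose r s := p (take n.+1 s) * p (behead s) / p (take n (behead s)).
have pos s : size s = n.+2 -> 0 < p s ->
    [/\ 0 < p (take n.+1 s), 0 < p (behead s) & 0 < p (take n (behead s))].
  move=> ss ps; have h1 : 0 < p (take n.+1 s).
    by apply: (@process_prefix _ (drop n.+1 s)); rewrite cat_take_drop.
  have h2 : 0 < p (behead s).
    by rewrite -drop1; apply: (@process_suffix (take 1 s)); rewrite cat_take_drop.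
  split=> //; apply: (@process_prefix _ (drop n (behead s))).
  by rewrite cat_take_drop.
have : expect n.+2 (fun s => ln (r s) - ln (p s)) <= 0.
  apply: gibbs.
  - by move=> s; rewrite /r !mulr_ge0 ?invr_ge0 ?p_ge0.
  - by move=> s ss /(pos s ss)[? ? ?]; rewrite /r divr_gt0 // mulr_gt0.
  rewrite sum_wordsS exchange_big /=.
  have E (s : n.+1.-tuple A) : \sum_a r (a :: s) = p (take n s) * p s / p (take n s).
    by rewrite /r /= -!mulr_suml (process_cons hp).
  under eq_bigr do rewrite E.
  rewrite (sum_words_rcons _ (fun s => p (take n s) * p s / p (take n s))).
  rewrite -(process_total n); apply: ler_sum => u _.
  under eq_bigr do rewrite -cats1 take_size_cat ?size_tuple // cats1.
  rewrite -mulr_suml -mulr_sumr (process_rcons hp).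
  have := p_ge0 u; rewrite le_eqVlt => /orP[/eqP<-|pu]; first by rewrite !mul0r.
  by rewrite mulfK // gt_eqF.
have -> : expect n.+2 (fun s => ln (r s) - ln (p s)) =
    expect n.+2 (fun s => - ln (p s) - - ln (p (drop 1 s))
      - (- ln (p (take n.+1 s)) - - ln (p (take n (drop 1 s))))).
  apply: eq_bigr => s _; have := p_ge0 s; rewrite le_eqVlt => /orP[/eqP<-|ps].
    by rewrite !mul0r.
  have [|? ? ?] := pos s _ ps; first by rewrite size_tuple.
  rewrite /r ln_div ?posrE ?mulr_gt0 // lnM ?posrE // drop1 !opprK.
  by congr (_ * _); ring.
rewrite !expectB subr_le0.
rewrite (@expect_take _ _ (fun s => - ln (p s))) //.
rewrite (@expect_drop _ _ (fun s => - ln (p s))) //.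
rewrite (@expect_drop _ _ (fun s => - ln (p (take n s)))) // subn1 /=.
by rewrite (@expect_take _ _ (fun s => - ln (p s))).
Qed.

Lemma cond_entropy_le i j : (i <= j)%N -> cond_entropy j <= cond_entropy i.
Proof.
elim: j => [|j IH]; first by rewrite leqn0 => /eqP ->.
rewrite leq_eqVlt => /orP[/eqP -> //|ij].
exact: le_trans (cond_entropy_decr j) (IH ij).
Qed.

Lemma sum_cond_entropy n m :
  \sum_(n <= i < n + m) cond_entropy i = entropy (n + m) - entropy n.
Proof. by rewrite telescope_sumr // leq_addr. Qed.

Section Mixture.
Variables (K : finType) (w g : K -> seq A -> R) (pi : K -> R).
Hypotheses (w_ge0 : forall z u, 0 <= w z u) (g_ge0 : forall z v, 0 <= g z v).
Hypothesis w_total : forall z i, \sum_(u : i.-tuple A) w z u = pi z.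
Hypothesis p_cat : forall u v, p (u ++ v) = \sum_z w z u * g z v.

Let pi_ge0 z : 0 <= pi z.
Proof. by rewrite -(w_total z 0) sumr_ge0. Qed.

Let pE v : p v = \sum_z pi z * g z v.
Proof.
rewrite -(process_catl 0 v); under eq_bigr do rewrite p_cat.
by rewrite exchange_big; apply: eq_bigr => z _; rewrite -mulr_suml w_total.
Qed.

(** The chi-square form of the bound on mutual information.  The likelihood
    ratio of (u, v) is the sum over z of P(z | u) g_z(v) / p(v), and
    g_z(v) / p(v) <= 1 / pi_z; averaging P(z | u) / pi_z over u gives 1 for each
    of the #|K| values of z. *)
Lemma mixture_chi2 i j :
  \sum_(u : i.-tuple A) \sum_(v : j.-tuple A)
     p (u ++ v) * p (u ++ v) / (p u * p v) <= #|K|%:R.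
Proof.
pose T z u := \sum_(v : j.-tuple A) p (u ++ v) * (w z u * g z v) / (p u * p v).
have -> : \sum_(u : i.-tuple A) \sum_(v : j.-tuple A)
     p (u ++ v) * p (u ++ v) / (p u * p v) =
   \sum_z \sum_(u : i.-tuple A) T z u.
  rewrite [RHS]exchange_big; apply: eq_bigr => u _; rewrite [RHS]exchange_big.
  by apply: eq_bigr => v _; rewrite -mulr_suml -mulr_sumr -p_cat.
rewrite -sum1_card natr_sum; apply: ler_sum => z _.
have := pi_ge0 z; rewrite le_eqVlt => /orP[/eqP z0|z0].
  rewrite big1 // => u _; rewrite /T big1 // => v _.
  have -> : w z u = 0; last by rewrite mul0r mulr0 mul0r.
  apply/eqP; have /eqP := w_total z i; rewrite -z0 psumr_eq0 // => /allP.
  by move=> /(_ u); rewrite mem_index_enum; apply.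
have g_le v : pi z * g z v <= p v.
  by rewrite pE (bigD1 z) //= lerDl sumr_ge0 // => y _; rewrite mulr_ge0.
apply: (@le_trans _ _ (\sum_(u : i.-tuple A) w z u / pi z)); last first.
  by rewrite -mulr_suml w_total divff // gt_eqF.
apply: ler_sum => u _.
apply: (@le_trans _ _ (\sum_(v : j.-tuple A) p (u ++ v) * (w z u / pi z / p u))); last first.
  rewrite -mulr_suml process_catr; have := p_ge0 u; rewrite le_eqVlt => /orP[/eqP<-|pu].
    by rewrite mul0r divr_ge0.
  by rewrite mulrC mulfVK // gt_eqF.
apply: ler_sum => v _; have := p_ge0 (u ++ v); rewrite le_eqVlt => /orP[/eqP<-|puv].
  by rewrite !mul0r.
have pu := process_prefix puv; have pv := process_suffix puv.
rewrite -mulrA ler_pM2l // ler_pdivrMr ?mulr_gt0 //.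
have -> : w z u / pi z / p u * (p u * p v) = w z u * (p v / pi z).
  by field; rewrite !gt_eqF.
by apply: ler_wpM2l => //; rewrite ler_pdivlMr // mulrC.
Qed.

(** The mean of the logarithm of the likelihood ratio, the mutual information
    H(i) + H(j) - H(i + j), is at most the logarithm of its mean, which
    [mixture_chi2] bounds. *)
Lemma mixture_entropy i j : (0 < #|K|)%N ->
  entropy i + entropy j - ln #|K|%:R <= entropy (i + j).
Proof.
move=> K0; have k0 : (0 : R) < #|K|%:R by rewrite ltr0n.
pose r s := p s * p s / (p (take i s) * p (drop i s)) / #|K|%:R.
have pos s : 0 < p s -> 0 < p (take i s) /\ 0 < p (drop i s).
  move=> ps; split.
    by apply: (@process_prefix _ (drop i s)); rewrite cat_take_drop.
  by apply: (@process_suffix (take i s)); rewrite cat_take_drop.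
have : expect (i + j) (fun s => ln (r s) - ln (p s)) <= 0.
  apply: gibbs.
  - by move=> s; rewrite /r !mulr_ge0 ?invr_ge0 ?mulr_ge0 ?p_ge0.
  - by move=> s _ ps; have [? ?] := pos s ps; rewrite /r !divr_gt0 // mulr_gt0.
  rewrite (sum_words_cat _ _ r) /r; under eq_bigr => u _ do
    under eq_bigr => v _ do
      rewrite take_size_cat ?size_tuple // drop_size_cat ?size_tuple //.
  under eq_bigr do rewrite -mulr_suml.
  by rewrite -mulr_suml ler_pdivrMr // mul1r; exact: mixture_chi2.
have -> : expect (i + j) (fun s => ln (r s) - ln (p s)) =
    expect (i + j) (fun s => - ln (p (take i s)) + - ln (p (drop i s))
      - - ln (p s) - ln #|K|%:R).
  apply: eq_bigr => s _; have := p_ge0 s; rewrite le_eqVlt => /orP[/eqP<-|ps].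
    by rewrite !mul0r.
  have [? ?] := pos s ps; congr (_ * _).
  rewrite /r ln_div ?posrE ?divr_gt0 ?mulr_gt0 // ln_div ?posrE ?mulr_gt0 //.
  by rewrite !lnM ?posrE //; ring.
rewrite 2!expectB expectD expect_cst.
rewrite (@expect_take _ _ (fun s => - ln (p s))) ?leq_addr //.
rewrite (@expect_drop _ _ (fun s => - ln (p s))) ?leq_addr // addKn.
by rewrite /entropy; lra.
Qed.

(** Summing conditional entropies over the block 0..m bounds (m + 1) h_m from
    above by an entropy, summing them over n..n+m bounds (m + 1) h_n from below;
    the difference is a mutual information. *)
Lemma mixture_cond_entropy m n : (0 < #|K|)%N ->
  m.+1%:R * (cond_entropy m - cond_entropy n) <= ln #|K|%:R.
Proof.
move=> K0; have S1 : m.+1%:R * cond_entropy m <= entropy m.+1.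
  have := sum_cond_entropy 0 m.+1; rewrite add0n entropy0 subr0 => <-.
  rewrite mulr_natl -[X in _ *+ X]subn0 -sumr_const_nat.
  by apply: ler_sum_nat => i; rewrite ltnS; apply: cond_entropy_le.
have S2 : entropy (n + m.+1) - entropy n <= m.+1%:R * cond_entropy n.
  rewrite -sum_cond_entropy mulr_natl -[X in _ *+ X](addKn n) -sumr_const_nat.
  by apply: ler_sum_nat => i /andP[ni _]; apply: cond_entropy_le.
have := mixture_entropy n m.+1 K0; lra.
Qed.

End Mixture.

End Process.

(** * Hidden Markov models *)

Section HMM.
Variables (R : realType) (k l : nat) (M : 'M[R]_k) (T : 'M[R]_(k, l)).
Hypotheses (hM : row_stochastic M) (hT : row_stochastic T).

(** Emitting x from the current state and then moving; words act by products
    of these matrices, which makes concatenation and stationarity algebraic. *)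
Definition emit (x : 'I_l) : 'M[R]_k := \matrix_(i, j) (T i x * M i j).

Definition word_mx (s : seq 'I_l) : 'M[R]_k :=
  foldr (fun x W => emit x *m W) 1%:M s.

Definition hmm_prob (pi : 'rV[R]_k) (s : seq 'I_l) : R :=
  (pi *m word_mx s *m const_mx 1 : 'cV_1) ord0 ord0.

Lemma word_mx_cat u v : word_mx (u ++ v) = word_mx u *m word_mx v.
Proof. by elim: u => [|x u IH] /=; rewrite ?mul1mx // IH mulmxA. Qed.

Lemma sum_emit : \sum_x emit x = M.
Proof.
apply/matrixP => i j; rewrite summxE; under eq_bigr do rewrite mxE.
by rewrite -mulr_suml (hT i).2 mul1r.
Qed.

Lemma mulmx_const1 : M *m const_mx 1 = const_mx 1 :> 'cV_k.
Proof.
apply/matrixP => i j; rewrite !mxE; under eq_bigr do rewrite mxE mulr1.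
exact: (hM i).2.
Qed.

Lemma emit_ge0 x i j : 0 <= emit x i j.
Proof. by rewrite mxE mulr_ge0 ?(hT i).1 ?(hM i).1. Qed.

Lemma word_mx_ge0 s i j : 0 <= word_mx s i j.
Proof.
elim: s i j => [|x s IH] i j /=; first by rewrite mxE ler0n.
by rewrite mxE sumr_ge0 // => h _; rewrite mulr_ge0 ?emit_ge0.
Qed.

(** The induction removes the first letter x0, which replaces the initial vector
    pi by [pi *m emit x0]; hence pi is arbitrary here. *)
Lemma hmm_lawE (pi : 'rV[R]_k) n (x : n.+1.-tuple 'I_l) :
  hmm_law pi M T x = hmm_prob pi x.
Proof.
elim: n pi x => [|n IH] pi; case/tupleP => x0 x.
  rewrite /hmm_law sum_tuplesS /= tuple0 /= /hmm_prob /= mulmx1 -mulmxA.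
  rewrite [RHS]mxE; apply: eq_bigr => z _.
  rewrite (big_pred1 [tuple]); last by move=> t; apply/esym/eqP; exact: tuple0.
  rewrite /markov_law /emission_law big_ord0 big_ord1 mulr1 theadE !(tnth_nth z) /=.
  rewrite (tnth_nth x0) /=; congr (_ * _); rewrite [RHS]mxE.
  under eq_bigr do rewrite !mxE mulr1.
  by rewrite -mulr_sumr (hM z).2 mulr1.
rewrite /hmm_prob /= mulmxA -/(hmm_prob (pi *m emit x0) x) -IH /hmm_law.
rewrite sum_tuplesS exchange_big /=; apply: eq_bigr => z _.
have E z0 : markov_law pi M [tuple of z0 :: z] * emission_law T [tuple of z0 :: z] [tuple of x0 :: x]
   = pi ord0 z0 * emit x0 z0 (thead z) *
    (\prod_(t < n) M (tnth z (widen_ord (leqnSn n) t)) (tnth z (lift ord0 t)) *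
      emission_law T z x).
  rewrite /markov_law /emission_law theadE big_ord_recl [X in _ * X = _]big_ord_recl.
  have -> : tnth [tuple of z0 :: z] (widen_ord (leqnSn n.+1) ord0) = z0.
    by rewrite (tnth_nth z0).
  have -> : tnth [tuple of z0 :: z] (lift ord0 ord0) = thead z.
    by rewrite (tnth_nth z0) /thead (tnth_nth z0).
  have -> : tnth [tuple of z0 :: z] ord0 = z0 by rewrite (tnth_nth z0).
  have -> : tnth [tuple of x0 :: x] ord0 = x0 by rewrite (tnth_nth x0).
  rewrite mxE; set P := \prod_(t < n) _; set Q := \prod_(t < n.+1) _.
  have -> : P = \prod_(t < n) M (tnth z (widen_ord (leqnSn n) t)) (tnth z (lift ord0 t)).
    by apply: eq_bigr => t _; congr (M _ _); rewrite !(tnth_nth z0).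
  have -> : Q = \prod_(t < n.+1) T (tnth z t) (tnth x t).
    by apply: eq_bigr => t _; congr (T _ _); [rewrite !(tnth_nth z0)|rewrite !(tnth_nth x0)].
  by ring.
under eq_bigr do rewrite E.
by rewrite -mulr_suml /markov_law -mulrA [in RHS]mxE.
Qed.

Variable pi : 'rV[R]_k.
Hypothesis hpi : stationary pi M.

Let pi_ge0 i : 0 <= pi ord0 i. Proof. exact: hpi.1.1. Qed.

Lemma hmm_process : stationary_process (hmm_prob pi).
Proof.
split.
- move=> s; rewrite /hmm_prob mxE sumr_ge0 // => j _; rewrite mulr_ge0 // !mxE ?ler01 //.
  by rewrite sumr_ge0 // => i _; rewrite mulr_ge0 ?word_mx_ge0.
- rewrite /hmm_prob /= mulmx1 mxE -[RHS]hpi.1.2.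
  by apply: eq_bigr => j _; rewrite mxE mulr1.
- move=> s; rewrite /hmm_prob -summxE; congr (_ _ ord0 ord0).
  under eq_bigr do rewrite -cats1 word_mx_cat /= mulmx1 -mulmxA.
  rewrite -mulmx_sumr -[RHS]mulmxA; congr (_ *m _).
  under eq_bigr do rewrite -mulmxA.
  by rewrite -mulmx_sumr -mulmx_suml sum_emit mulmx_const1.
- move=> s; rewrite /hmm_prob -summxE; congr (_ _ ord0 ord0) => /=.
  rewrite -mulmx_suml; congr (_ *m _).
  under eq_bigr do rewrite mulmxA.
  by rewrite -mulmx_suml -mulmx_sumr sum_emit hpi.2.
Qed.

Lemma hmm_mixture m n : (0 < k)%N ->
  m.+1%:R * (cond_entropy (hmm_prob pi) m - cond_entropy (hmm_prob pi) n)
    <= ln k%:R.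
Proof.
move=> k0; rewrite -[in leRHS](card_ord k).
apply: (mixture_cond_entropy hmm_process (w := fun z u => (pi *m word_mx u) ord0 z)
  (g := fun z v => (word_mx v *m (const_mx 1 : 'cV_k)) z ord0) (pi := pi ord0)).
- by move=> z u; rewrite mxE sumr_ge0 // => i _; rewrite mulr_ge0 ?word_mx_ge0.
- move=> z v; rewrite mxE sumr_ge0 // => i _.
  by rewrite mulr_ge0 ?word_mx_ge0 // mxE ler01.
- move=> z i; rewrite -summxE; congr (_ _ ord0 z).
  elim: i => [|i IH]; first by rewrite (sum_words0 (fun u => pi *m word_mx u)) mulmx1.
  rewrite (sum_wordsS _ (fun u => pi *m word_mx u)) exchange_big /= -[RHS]IH.
  apply: eq_bigr => u _; under eq_bigr do rewrite mulmxA.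
  by rewrite -mulmx_suml -mulmx_sumr sum_emit hpi.2.
- by move=> u v; rewrite /hmm_prob word_mx_cat !mulmxA -mulmxA mxE.
- by rewrite card_ord.
Qed.

End HMM.

(** * Regret of add-one smoothing *)

Section Laplace.
Variable R : realType.

Lemma binomial_term_le (x y : R) i j : 0 <= x -> 0 <= y ->
  x ^+ i / i`!%:R * (y ^+ j / j`!%:R) <= (x + y) ^+ (i + j) / (i + j)`!%:R.
Proof.
move=> x0 y0.
have f0 n : (0 : R) < n`!%:R by rewrite ltr0n fact_gt0.
rewrite ler_pdivlMr //.
have -> : x ^+ i / i`!%:R * (y ^+ j / j`!%:R) * (i + j)`!%:R =
    x ^+ i * y ^+ j *+ 'C(i + j, j).
  have := bin_fact (leq_addl i j); rewrite addnK => <-.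
  rewrite !natrM -mulr_natr; field.
  by rewrite !gt_eqF.
rewrite exprDn (bigD1 (inord j)) //= inordK ?ltnS ?leq_addl // addnK lerDl.
by apply: sumr_ge0 => k _; rewrite mulrn_wge0 // mulr_ge0 // exprn_ge0.
Qed.

(** One term of the multinomial expansion of (sum of x)^n, which is at most 1.
    The binomial case is iterated over the letters. *)
Lemma multinomial_term_le (A : finType) (x : A -> R) (n : A -> nat) :
  (forall a, 0 <= x a) -> \sum_a x a <= 1 ->
  \prod_a x a ^+ n a * (\sum_a n a)%N`!%:R <= \prod_a (n a)`!%:R.
Proof.
move=> x0 x1; have f0 k : (0 : R) < k`!%:R by rewrite ltr0n fact_gt0.
have : \prod_a (x a ^+ n a / (n a)`!%:R) <=
    (\sum_a x a) ^+ (\sum_a n a)%N / (\sum_a n a)%N`!%:R.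
  have [] // : 0 <= \sum_a x a /\ \prod_a (x a ^+ n a / (n a)`!%:R) <=
      (\sum_a x a) ^+ (\sum_a n a)%N / (\sum_a n a)%N`!%:R.
  elim/big_rec3: _ => [|a i X p _ [X0 le]]; first by rewrite expr0 fact0 divr1.
  split; first exact: addr_ge0.
  apply: le_trans (binomial_term_le _ _ (x0 a) X0).
  by rewrite ler_wpM2l // mulr_ge0 ?exprn_ge0 // invr_ge0 ltW.
rewrite prodf_div ler_pdivrMr ?prodr_gt0 // => h.
rewrite -ler_pdivlMr //; apply: le_trans h _.
rewrite mulrC ler_wpM2l //; first by rewrite prodr_ge0 // => *; rewrite ltW.
by apply: ler_piMl; [rewrite invr_ge0 ltW | rewrite exprn_ile1 // sumr_ge0].
Qed.

Lemma prod_expr_pred1 (T : finType) (F : T -> R) x :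
  \prod_t F t ^+ (x == t) = F x.
Proof.
rewrite (bigD1 x) //= eqxx expr1 big1 ?mulr1 // => t.
by rewrite eq_sym => /negbTE->.
Qed.

Lemma prod_fact_incr (T : finType) k (n : T -> nat) x :
  \prod_t ((x == t) + n t + k)`!%:R = (n x + k).+1%:R * \prod_t (n t + k)`!%:R :> R.
Proof.
rewrite (bigD1 x) //= [in RHS](bigD1 x) //= eqxx !addSn factS natrM !mulrA.
congr (_ * _); apply: eq_bigr => t.
by rewrite eq_sym => /negbTE->.
Qed.

Variables (C A : finType).
Implicit Types (ps : seq (C * A)).

Definition ctx_count ps c := count (fun q : C * A => q.1 == c) ps.

Definition laplace_step ps (q : C * A) : R :=
  (count_mem q ps).+1%:R / (ctx_count ps q.1 + #|A|)%:R.

(** The probability that sequential add-one smoothing assigns to the letters of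
    a list of (context, letter) pairs, most recent pair first. *)
Fixpoint laplace ps : R :=
  if ps is q :: ps' then laplace_step ps' q * laplace ps' else 1.

Lemma ctx_countE ps c : ctx_count ps c = (\sum_a count_mem (c, a) ps)%N.
Proof.
elim: ps => [|[c' a'] ps IH] /=; first by rewrite big1.
rewrite big_split /= -IH; congr (_ + _)%N.
under eq_bigr do rewrite xpair_eqE.
rewrite (bigD1 a') //= eqxx andbT big1 => [|a]; first by rewrite addn0.
by rewrite eq_sym => /negbTE->; rewrite andbF.
Qed.

(** The sequential product depends only on the counts: the numerators and the
    denominators telescope to factorials. *)
Lemma laplaceE ps : (0 < #|A|)%N ->
  laplace ps * \prod_c (ctx_count ps c + #|A|.-1)`!%:R =
  \prod_q (count_mem q ps)`!%:R * (#|A|.-1)`!%:R ^+ #|C|.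
Proof.
move=> A0; elim: ps => [|[c a] ps IH] /=.
  by rewrite mul1r prodr_const big1 ?mul1r // => q _; rewrite fact0.
rewrite (prod_fact_incr _ (ctx_count ps)) /laplace_step /=.
have := prod_fact_incr 0 (fun q => count_mem q ps) (c, a).
under eq_bigr do rewrite addn0; move=> ->; rewrite addn0.
under [X in _ = _ * X * _]eq_bigr do rewrite addn0.
rewrite -[RHS]mulrA -IH -addnS prednK //.
by field; rewrite -natrD pnatr_eq0 addn_eq0 negb_and -!lt0n A0 orbT.
Qed.

Lemma fact_addn_le n k : ((n + k)`! <= n`! * (n + k) ^ k)%N.
Proof.
elim: k => [|k IH]; first by rewrite addn0 muln1.
rewrite addnS factS expnS mulnCA leq_mul2l /=.
apply: leq_trans IH _; rewrite leq_mul2l; apply/orP; right.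
by case: k => // k; rewrite leq_exp2r.
Qed.

(** For one context with counts n_a of sum n, the likelihood is at most
    prod n_a! / n! by the multinomial bound, whereas smoothing assigns
    prod n_a! (l - 1)! / (n + l - 1)!; the quotient is polynomial in n. *)
Lemma laplace_regret (theta : C -> A -> R) ps : (0 < #|A|)%N ->
  (forall c a, 0 <= theta c a) -> (forall c, \sum_a theta c a <= 1) ->
  \prod_(q <- ps) theta q.1 q.2 <=
    laplace ps * ((size ps + #|A|) ^ (#|A| * #|C|))%:R.
Proof.
move=> A0 t0 t1; set B := (size ps + #|A|)%N; set l := #|A|.
have f0 n : (0 : R) < n`!%:R by rewrite ltr0n fact_gt0.
have -> : \prod_(q <- ps) theta q.1 q.2 =
    \prod_c \prod_a theta c a ^+ count_mem (c, a) ps.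
  rewrite pair_bigA /=.
  elim: ps {B} => [|q ps IH]; first by rewrite big_nil big1 // => *; rewrite expr0.
  rewrite big_cons IH -(prod_expr_pred1 (fun q => theta q.1 q.2)) -big_split /=.
  by apply: eq_bigr => -[c a] _ /=; rewrite exprD.
apply: (@le_trans _ _ (\prod_c (\prod_a (count_mem (c, a) ps)`!%:R *
    (B ^ l)%:R / (ctx_count ps c + l.-1)`!%:R))).
  apply: ler_prod => c _; apply/andP; split.
    by rewrite prodr_ge0 // => a _; rewrite exprn_ge0.
  have := multinomial_term_le (fun a => count_mem (c, a) ps) (t0 c) (t1 c).
  rewrite -ctx_countE -ler_pdivlMr // => /le_trans; apply.
  rewrite -mulrA ler_wpM2l ?prodr_ge0 //.
  rewrite ler_pdivlMr // mulrC ler_pdivrMr // -natrM ler_nat mulnC.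
  apply: leq_trans (fact_addn_le _ _) _; rewrite leq_mul2l; apply/orP; right.
  apply: (@leq_trans (B ^ l.-1)); last by rewrite leq_pexp2l //; rewrite /B; lia.
  have := count_size (fun q : C * A => q.1 == c) ps.
  rewrite -/(ctx_count ps c) => h.
  by case: (posnP l.-1) => [->|?] //; rewrite leq_exp2r // /B -/l; lia.
rewrite prodf_div big_split /= prodr_const -natrX -expnM.
rewrite ler_pdivrMr ?prodr_gt0 // mulrAC laplaceE //.
rewrite pair_bigA /= (eq_bigr (fun q => (count_mem q ps)`!%:R)); last by case.
rewrite ler_wpM2r // ler_peMr ?prodr_ge0 //.
by rewrite exprn_ege1 // ler1n fact_gt0.
Qed.

End Laplace.

(** * Redundancy of the averaged predictor *)

Section Prediction.
Variables (R : realType) (A : finType) (a0 : A) (m : nat).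
Implicit Types (w : seq A).

Definition context w t : m.-tuple A := [tuple nth a0 w (t + i) | i < m].

(** The letter at position t + m of w together with the m letters before it. *)
Definition gram w t := (context w t, nth a0 w (t + m)).

Definition grams w t := [seq gram w j | j <- rev (iota 0 t)].

Definition step_at w t : R := laplace_step R (grams w t) (gram w t).

(** The last letter of w is the one to be predicted: in the window from s on it
    is the letter of gram number N - s. *)
Definition averaged N w : R :=
  N.+1%:R^-1 * \sum_(s < N.+1) step_at (drop s w) (N - s).

Lemma gramsS w t : grams w t.+1 = gram w t :: grams w t.
Proof. by rewrite /grams -addn1 iotaD rev_cat. Qed.

Lemma size_grams w t : size (grams w t) = t.
Proof. by rewrite size_map size_rev size_iota. Qed.

Lemma grams_prod (F : m.-tuple A * A -> R) w t :
  \prod_(q <- grams w t) F q = \prod_(j < t) F (gram w j).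
Proof.
elim: t => [|t IH]; first by rewrite /grams big_nil big_ord0.
by rewrite gramsS big_cons big_ord_recr /= IH mulrC.
Qed.

Lemma laplace_grams w t : laplace R (grams w t) = \prod_(j < t) step_at w j.
Proof.
elim: t => [|t IH]; first by rewrite /grams big_ord0.
by rewrite gramsS big_ord_recr /= IH mulrC.
Qed.

Lemma context_take w t : (t + m <= size w)%N -> context w t = take m (drop t w) :> seq A.
Proof.
move=> tm; have sz : size (take m (drop t w)) = m.
  by rewrite size_takel // size_drop; lia.
apply: (@eq_from_nth _ a0); rewrite ?size_tuple ?sz // => i im.
rewrite nth_take // nth_drop -(tnth_nth _ _ (Ordinal im)) tnth_mktuple //.
Qed.

Lemma gram_take i w t : (t + m < i)%N -> gram (take i w) t = gram w t.
Proof.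
move=> ti; rewrite /gram nth_take //; congr (_, _); apply: eq_mktuple => j.
by rewrite nth_take //; have := ltn_ord j; lia.
Qed.

Lemma gram_drop i w t : gram (drop i w) t = gram w (i + t).
Proof.
rewrite /gram nth_drop addnA; congr (_, _); apply: eq_mktuple => j.
by rewrite nth_drop addnA.
Qed.

Lemma step_at_take i w t : (t + m < i)%N -> step_at (take i w) t = step_at w t.
Proof.
move=> ti; rewrite /step_at gram_take //; congr laplace_step.
apply/eq_in_map => j; rewrite mem_rev mem_iota => jt; apply: gram_take; lia.
Qed.

Lemma step_at_gt0 w t : 0 < step_at w t.
Proof.
rewrite divr_gt0 // ltr0n addn_gt0; apply/orP; right.
by apply/card_gt0P; exists a0.
Qed.

Lemma averaged_gt0 N w : 0 < averaged N w.
Proof.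
rewrite mulr_gt0 ?invr_gt0 ?ltr0n // big_ord_recl ltr_pwDl ?step_at_gt0 //.
by rewrite sumr_ge0 // => i _; rewrite ltW ?step_at_gt0.
Qed.

(** Jensen's inequality for the logarithm, again from ln y <= y - 1. *)
Lemma ln_averaged N w :
  - ln (averaged N w) <=
  N.+1%:R^-1 * \sum_(s < N.+1) - ln (step_at (drop s w) (N - s)).
Proof.
set Q := averaged N w; have Q0 : 0 < Q := averaged_gt0 N w.
have N0 : 0 < N.+1%:R :> R by rewrite ltr0n.
have sQ : \sum_(s < N.+1) step_at (drop s w) (N - s) = N.+1%:R * Q.
  by rewrite /Q /averaged mulrA divff ?mul1r // gt_eqF.
rewrite ler_pdivlMl // -subr_le0.
have -> : N.+1%:R * - ln Q = \sum_(s < N.+1) - ln Q.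
  by rewrite sumr_const card_ord mulr_natl.
rewrite -sumrB.
apply: (@le_trans _ _ (\sum_(s < N.+1) (step_at (drop s w) (N - s) / Q - 1))).
  apply: ler_sum => s _; have s0 := step_at_gt0 (drop s w) (N - s).
  have := ln_le_subr1 (divr_gt0 s0 Q0).
  by rewrite ln_div ?posrE //; lra.
rewrite sumrB -mulr_suml sQ sumr_const card_ord mulfK ?gt_eqF //.
by rewrite subrr.
Qed.

Variable p : seq A -> R.
Hypothesis hp : stationary_process p.

(** The conditional law of the process given m letters, the competitor in the
    regret bound. *)
Let theta (c : m.-tuple A) a := p (rcons c a) / p c.

Let theta_ge0 c a : 0 <= theta c a.
Proof. by rewrite divr_ge0 // (process_ge0 hp). Qed.

Let theta_le1 c : \sum_a theta c a <= 1.
Proof.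
rewrite -mulr_suml (process_rcons hp).
by have [->|/divff->] := eqVneq (p c) 0; rewrite ?mul0r.
Qed.

Let ln_theta w t : (t + m < size w)%N -> 0 < p w ->
  0 < theta (gram w t).1 (gram w t).2 /\
  ln (theta (gram w t).1 (gram w t).2) =
    ln (p (take m.+1 (drop t w))) - ln (p (take m (drop t w))).
Proof.
move=> tm pw; have sz : (m < size (drop t w))%N by rewrite size_drop; lia.
have pd : 0 < p (drop t w).
  by apply: (process_suffix hp (u := take t w)); rewrite cat_take_drop.
have pt i : 0 < p (take i (drop t w)).
  by apply: (process_prefix hp (v := drop i (drop t w))); rewrite cat_take_drop.
rewrite /theta /gram /= context_take; last by lia.
rewrite -nth_drop -take_nth //.
by split; [rewrite divr_gt0 | rewrite ln_div ?posrE].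
Qed.

(** The windows are exchanged for prefixes by stationarity; then the losses add
    up to the logarithm of [laplace], to which [laplace_regret] applies. *)
Lemma redundancy_bound N :
  expect p (m + N).+1
    (fun w => ln (p w) - ln (p (take (m + N) w)) - ln (averaged N w)) <=
  cond_entropy p m - cond_entropy p (m + N) +
    (#|A| * #|A| ^ m)%:R * ln (N.+1 + #|A|)%:R / N.+1%:R.
Proof.
have A0 : (0 < #|A|)%N by apply/card_gt0P; exists a0.
have N0 : 0 < N.+1%:R :> R by rewrite ltr0n.
set n := (m + N)%N; set K : R := (#|A| * #|A| ^ m)%:R * ln (N.+1 + #|A|)%:R.
pose loss w := - ln (averaged N w).
have E1 : expect p n.+1 (fun w => ln (p w) - ln (p (take n w)) - ln (averaged N w)) =
    expect p n.+1 loss - cond_entropy p n.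
  rewrite expectB expectB (expect_take hp (fun s => ln (p s))) //.
  by rewrite /cond_entropy /entropy /loss !expectN; lra.
suff : expect p n.+1 loss <= cond_entropy p m + K / N.+1%:R.
  by move=> h; rewrite E1 (addrAC (cond_entropy p m)) lerD2r.
apply: (@le_trans _ _ (N.+1%:R^-1 * \sum_(t < N.+1)
    expect p n.+1 (fun w => - ln (step_at w t)))).
  apply: (le_trans (expect_le hp (fun w _ _ => ln_averaged N w))).
  rewrite expectZ expect_sum; apply: ler_wpM2l; first by rewrite invr_ge0 ltW.
  rewrite [leRHS](reindex_inj rev_ord_inj) /= le_eqVlt; apply/orP; left; apply/eqP.
  apply: eq_bigr => s _; rewrite subSS; have := ltn_ord s; rewrite ltnS => sN.
  rewrite (expect_drop hp (fun w => - ln (step_at w (N - s)))); last by rewrite /n; lia.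
  rewrite -(@expect_take _ _ _ hp (n.+1 - s) n.+1); last by lia.
  apply: eq_bigr => w _; rewrite step_at_take //; rewrite /n; lia.
rewrite -expect_sum mulrC ler_pdivrMr // mulrDl mulfVK ?gt_eqF //.
apply: (@le_trans _ _ (expect p n.+1 (fun w => K + \sum_(t < N.+1)
   (- ln (p (take m.+1 (drop t w))) - - ln (p (take m (drop t w))))))).
  apply: (expect_le hp) => w sw pw.
  have tm (t : 'I_N.+1) : (t + m < size w)%N by rewrite sw /n; have := ltn_ord t; lia.
  have lnprod (F : 'I_N.+1 -> R) : (forall t, 0 < F t) ->
      ln (\prod_(t < N.+1) F t) = \sum_(t < N.+1) ln (F t).
    move=> F0; have [] // : 0 < \prod_(t < N.+1) F t /\
       ln (\prod_(t < N.+1) F t) = \sum_(t < N.+1) ln (F t).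
    elim/big_rec2: _ => [|t x y _ [y0 <-]]; first by rewrite ln1.
    by rewrite lnM ?posrE // mulr_gt0.
  have := laplace_regret (grams w N.+1) A0 theta_ge0 theta_le1.
  rewrite (grams_prod (fun q => theta q.1 q.2)) laplace_grams size_grams card_tuple.
  have S0 : 0 < ((N.+1 + #|A|) ^ (#|A| * #|A| ^ m))%:R :> R.
    by rewrite ltr0n expn_gt0.
  rewrite -ler_ln ?posrE ?mulr_gt0 ?prodr_gt0 // => [|t _|t _]; last 2 first.
  - exact: (ln_theta (tm t) pw).1.
  - exact: step_at_gt0.
  rewrite lnM ?posrE ?prodr_gt0 // => [|t _]; last exact: step_at_gt0.
  rewrite !lnprod => [|t|t]; last 2 first.
  - exact: step_at_gt0.
  - exact: (ln_theta (tm t) pw).1.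
  rewrite natrX lnXn ?ltr0n // -[_ *+ (#|A| * _)]mulr_natl -/K.
  under eq_bigr do rewrite (ln_theta (tm _) pw).2.
  rewrite sumrN; under [X in _ -> _ <= _ + X]eq_bigr do rewrite -opprD.
  by rewrite sumrN; lra.
rewrite expectD (expect_cst hp) expect_sum addrC lerD2r.
rewrite -[N.+1 in leRHS]card_ord mulr_natr -sumr_const.
apply: ler_sum => t _; have tN := ltn_ord t.
rewrite expectB.
rewrite (expect_drop hp (fun w => - ln (p (take m.+1 w)))); last by rewrite /n; lia.
rewrite (expect_drop hp (fun w => - ln (p (take m w)))); last by rewrite /n; lia.
rewrite (expect_take hp (fun w => - ln (p w))); last by rewrite /n; lia.
rewrite (expect_take hp (fun w => - ln (p w))) //; rewrite /n; lia.
Qed.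

End Prediction.

(** * The program and its running time *)

Section Machine.
Local Open Scope nat_scope.

(** The weakest precondition of a terminating run within b steps; the
    postcondition serves as continuation in [runs_seq]. *)
Definition runs (p : prog) (b : nat) (s : memory) (Q : memory -> Prop) : Prop :=
  exists t s', [/\ exec p s t s', t <= b & Q s'].

Lemma runs_weaken p b b' s (Q Q' : memory -> Prop) :
  runs p b s Q -> b <= b' -> (forall s', Q s' -> Q' s') -> runs p b' s Q'.
Proof.
move=> [t [s' [e tb q]]] bb' QQ'; exists t, s'; split=> //; last exact: QQ'.
exact: leq_trans bb'.
Qed.

Lemma runs_const i c s (Q : memory -> Prop) : Q (upd s i c) -> runs (Const i c) 1 s Q.
Proof. by move=> q; exists 1, (upd s i c); split=> //; constructor. Qed.

Lemma runs_add i j h s (Q : memory -> Prop) :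
  Q (upd s i (s j + s h)) -> runs (Add i j h) 1 s Q.
Proof. by move=> q; eexists 1, _; split; [constructor | | exact: q]. Qed.

Lemma runs_sub i j h s (Q : memory -> Prop) :
  Q (upd s i (s j - s h)) -> runs (Defs.Sub i j h) 1 s Q.
Proof. by move=> q; eexists 1, _; split; [constructor | | exact: q]. Qed.

Lemma runs_read i j s (Q : memory -> Prop) :
  Q (upd s i (s (s j))) -> runs (Read i j) 1 s Q.
Proof. by move=> q; eexists 1, _; split; [constructor | | exact: q]. Qed.

Lemma runs_write i j s (Q : memory -> Prop) :
  Q (upd s (s i) (s j)) -> runs (Write i j) 1 s Q.
Proof. by move=> q; eexists 1, _; split; [constructor | | exact: q]. Qed.

Lemma runs_seq p q b b' s (Q : memory -> Prop) :
  runs p b s (fun s' => runs q b' s' Q) -> runs (Seq p q) (b + b') s Q.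
Proof.
move=> [t [s' [e tb [t' [s'' [e' tb' q']]]]]]; exists (t + t'), s''; split=> //.
  exact: exec_seq e e'.
exact: leq_add.
Qed.

Lemma runs_ifz i p q b b' s (Q : memory -> Prop) :
  (s i = 0 -> runs p b s Q) -> (s i <> 0 -> runs q b' s Q) ->
  runs (Ifz i p q) (b + b').+1 s Q.
Proof.
move=> hp hq; have [z|/eqP nz] := eqVneq (s i) 0.
  have [t [s' [e tb q']]] := hp z; exists t.+1, s'; split=> //; last by lia.
  exact: exec_ifz_true.
have [t [s' [e tb q']]] := hq nz; exists t.+1, s'; split=> //; last by lia.
exact: exec_ifz_false.
Qed.

(** A loop whose invariant is indexed by the value that its counter c takes: the
    body leads from index j + 1 to index j, and N bounds the iterations. *)
Lemma runs_while c p b N (I : nat -> memory -> Prop) s :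
  (forall j s, I j s -> s c = j) ->
  (forall j s, j < N -> I j.+1 s -> runs p b s (I j)) ->
  s c <= N -> I (s c) s -> runs (While c p) (N * b.+1).+1 s (I 0).
Proof.
move=> hc hp; move: {2}(s c) (erefl (s c)) => j; elim: j s N hp => [|j IH] s N hp.
  by move=> z _; rewrite z => i0; exists 1, s; split=> //; apply: exec_while_stop.
move=> z; rewrite z => jN ij.
have [t [s1 [e tb i1]]] := hp j s jN ij.
have c1 := hc _ _ i1.
have hp' j' s' : j' < N.-1 -> I j'.+1 s' -> runs p b s' (I j').
  by move=> ?; apply: hp; lia.
have [|t' [s2 [e' tb' i2]]] := IH s1 N.-1 hp' c1 _ ltac:(by rewrite c1); first by lia.
exists (t + t').+1, s2; split=> //.
  by apply: exec_while_step e e'; rewrite z.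
by case: N jN tb' {hp hp'} => //= N _; rewrite mulSn; lia.
Qed.

(** The frame condition of a subprogram: L lists the cells it may alter. *)
Definition changes_only (L : seq nat) (s s' : memory) : Prop :=
  forall i, i \notin L -> s' i = s i.

Notation Minus := Defs.Sub.
Notation "p ;; q" := (Seq p q) (at level 60, right associativity).

(* Registers are even cells below 64; the cell 64 + 2a buffers the numerator of
   the letter a until the input in the odd cells is no longer needed. *)
Notation rN := 0%N (only parsing).
Notation rL := 4%N (only parsing).
Notation rone := 6%N (only parsing).
Notation rm := 8%N (only parsing).
Notation rlast := 10%N (only parsing).
Notation ra := 12%N (only parsing).
Notation rc := 14%N (only parsing).
Notation rd := 16%N (only parsing).
Notation rout := 18%N (only parsing).
Notation rs := 20%N (only parsing).
Notation rw := 22%N (only parsing).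
Notation ri := 24%N (only parsing).
Notation rctr := 26%N (only parsing).
Notation racc := 28%N (only parsing).
Notation rt1 := 30%N (only parsing).
Notation rt2 := 32%N (only parsing).
Notation re := 34%N (only parsing).
Notation rp := 36%N (only parsing).
Notation rB := 38%N (only parsing).
Notation raddr := 40%N (only parsing).
Notation ru := 42%N (only parsing).
Notation rv := 44%N (only parsing).

Definition copy i j := Const i 0 ;; Add i i j.
Definition dec i := Minus i i rone.

Ltac exec_step := first
  [ apply: runs_seq | apply: runs_const | apply: runs_add | apply: runs_sub
  | apply: runs_read | apply: runs_write ].

Lemma updE s i v : upd s i v i = v. Proof. by rewrite /upd eqxx. Qed.

Lemma upd_ne s i v j : j != i -> upd s i v j = s j.
Proof. by rewrite /upd => /negbTE ->. Qed.

Lemma changes_only_trans L s1 s2 s3 :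
  changes_only L s1 s2 -> changes_only L s2 s3 -> changes_only L s1 s3.
Proof. by move=> h1 h2 i iL; rewrite h2 // h1. Qed.

Lemma changes_only_upd L s s' i v :
  i \in L -> changes_only L s s' -> changes_only L s (upd s' i v).
Proof.
move=> iL h j jL; rewrite upd_ne ?h //; by apply: contraNneq jL => ->.
Qed.

Lemma changes_only_sub (L L' : seq nat) s s' :
  {subset L <= L'} -> changes_only L s s' -> changes_only L' s s'.
Proof. by move=> LL h i iL; apply: h; apply: contra iL; apply: LL. Qed.

Definition multiply acc x y :=
  Const acc 0 ;; copy rctr x ;; While rctr (dec rctr ;; Add acc acc y).

Lemma runs_multiply acc x y X s :
  s rone = 1 -> s x <= X -> acc \notin [:: rone; rctr; x; y] ->
  rctr \notin [:: x; y] ->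
  runs (multiply acc x y) (3 * X + 4) s
    (fun s' => s' acc = s x * s y /\ changes_only [:: acc; rctr] s s').
Proof.
rewrite !inE !negb_or => one xX /and4P[a1 a2 a3 a4] /andP[c1 c2].
apply: (@runs_weaken _ (1 + (2 + (X * 3).+1))
 _ _ (fun s' => s' acc = s x * s y /\ changes_only [:: acc; rctr] s s')) => //; last by lia.
apply: runs_seq; apply: runs_const; apply: runs_seq.
apply: (@runs_seq _ _ 1 1); apply: runs_const; apply: runs_add.
pose I j s' := [/\ s' rctr = j, s' acc + j * s y = s x * s y
  & changes_only [:: acc; rctr] s s'].
set s1 := upd _ _ _; have s1c : s1 rctr = s x.
  by rewrite /s1 updE updE add0n !upd_ne // eq_sym.
apply: (@runs_weaken _ ((X * 3).+1) _ _ (I 0)); [apply: (@runs_while _ _ 2) | by [] |].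
- by move=> j s2 [].
- move=> j s2 _ [i1 i2 i3]; apply: (@runs_seq _ _ 1 1); apply: runs_sub; apply: runs_add.
  have fr k v : k \notin [:: acc; rctr] -> upd s2 rctr v k = s k.
    move=> kL; rewrite upd_ne ?i3 //; by move: kL; rewrite !inE negb_or => /andP[].
  split.
  + by rewrite upd_ne 1?eq_sym // updE i1 i3 ?one ?subn1 // !inE negb_or eq_sym a1.
  + rewrite updE upd_ne // [_ y]fr ?inE ?negb_or 1?eq_sym ?a4 1?eq_sym // -i2; lia.
  + by do 2![apply: changes_only_upd; rewrite ?inE ?eqxx ?orbT //].
- by rewrite s1c.
- split=> //.
    by rewrite s1c /s1 2?upd_ne ?updE // add0n.
  by rewrite /s1; do 3![apply: changes_only_upd; rewrite ?inE ?eqxx ?orbT //].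
- by move=> s' [_ + ?]; rewrite addn0.
Qed.

Lemma runs_call p b s (Q Q' : memory -> Prop) :
  runs p b s Q -> (forall s', Q s' -> Q' s') -> runs p b s Q'.
Proof. by move=> h QQ'; exact: runs_weaken h (leqnn _) QQ'. Qed.

(** For 0 < d <= S this is S! / d, in a form that is computed without division. *)
Definition skipfact S d := \prod_(1 <= i < S.+1 | i != d) i.

Lemma skipfactE S d : 0 < d <= S -> d * skipfact S d = S`!.
Proof.
move=> /andP[d0 dS]; rewrite fact_prod [RHS](bigD1_seq d) /= ?iota_uniq //.
by rewrite mem_index_iota d0 ltnS.
Qed.

Lemma skipfact0 S : skipfact S 0 = S`!.
Proof.
rewrite fact_prod /skipfact [LHS]big_nat_cond [RHS]big_nat_cond.
by apply: eq_bigl => i; case: i => //= i; rewrite andbT.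
Qed.

Lemma skipfactS j d :
  skipfact j.+1 d = skipfact j d * (if j.+1 != d then j.+1 else 1).
Proof. by rewrite /skipfact big_mkcond big_nat_recr //= -big_mkcond. Qed.

Definition cost_prod_skipping S := S * (3 * S + 20) + 10.

Definition prod_skipping :=
  Const rw 1 ;; Add ri rN rL ;;
  While ri (Minus rt1 ri rd ;; Minus rt2 rd ri ;; Add rt1 rt1 rt2 ;;
            Ifz rt1 (Const rt1 0) (multiply racc ri rw ;; copy rw racc) ;; dec ri).

Ltac frame := repeat (apply: changes_only_upd; [by [] | ]).

Lemma runs_prod_skipping S s : s rone = 1 -> s rN + s rL = S ->
  runs prod_skipping (cost_prod_skipping S) s
    (fun s' => s' rw = skipfact S (s rd) /\
               changes_only [:: rw; ri; rt1; rt2; racc; rctr] s s').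
Proof.
move=> one sS; set L := (L in changes_only L).
pose I j s' := [/\ s' ri = j,
  s' rw * skipfact j (s rd) = skipfact S (s rd) & changes_only L s s'].
eapply runs_weaken.
- do 4 exec_step.
  apply: (@runs_while _ _ _ S I); first by move=> j s2 [].
  + move=> j s2 jS [i1 i2 i3].
    do 7 exec_step.
    eapply runs_call.
      eapply (@runs_ifz _ _ _ _ _ _ (fun s' => [/\ s' ri = j.+1,
         s' rw * skipfact j (s rd) = skipfact S (s rd)
         & changes_only L s s'])); rewrite /upd /= => e; rewrite i1 (i3 rd) // in e.
        exec_step; split; rewrite /upd /= //; last by frame.
        rewrite -i2 skipfactS; case: eqP => [_|?] /=; [by rewrite muln1 | lia].
      exec_step; eapply runs_call.
        by apply: (@runs_multiply _ _ _ S.+1); rewrite /upd /= ?(i3 rone) ?one //; lia.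
      move=> s3; rewrite /upd /= => -[e3 o3]; do 3 exec_step.
      split.
      * by rewrite /upd /= (o3 ri).
      * rewrite /upd /= e3 add0n -i2 i1.
        rewrite skipfactS; case: eqP => [?|_] /=; [lia | ring].
      * frame; apply: (@changes_only_trans _ _ _ _ i3).
        pose u := s2 ri - s2 rd; pose v := s2 rd - s2 ri.
        apply: (@changes_only_trans _ _ (upd (upd (upd s2 rt1 u) rt2 v) rt1 (u + v)));
          first by frame.
        by apply: changes_only_sub o3 => i; rewrite !inE => /orP[]/eqP->.
    move=> s3 [j1 j2 j3]; exec_step; split.
    * by rewrite /upd /= j1 (j3 rone) // one subn1.
    * by rewrite /upd /=.
    * by frame.
  + by rewrite /upd /= sS.
  + split; rewrite /upd /= ?sS //; last by frame.
    by rewrite mul1n.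
- rewrite /cost_prod_skipping; nia.
- by move=> s' [_]; rewrite /skipfact big_geq // muln1.
Qed.

Definition holds_word (x : nat -> nat) (s : memory) : Prop :=
  forall j, s j.*2.+1 = x j.

Lemma changes_only_word L x s s' :
  all (fun i => ~~ odd i) L -> changes_only L s s' ->
  holds_word x s -> holds_word x s'.
Proof.
move=> /allP hL o h j; rewrite o ?h //; apply/negP => /hL /=.
by rewrite odd_double.
Qed.

Lemma changes_only_seq (L L1 L2 : seq nat) s s1 s2 :
  changes_only L1 s s1 -> changes_only L2 s1 s2 ->
  all (mem L) (L1 ++ L2) -> changes_only L s s2.
Proof.
move=> o1 o2 /allP h; apply: (@changes_only_trans _ _ s1);
  [apply: changes_only_sub o1 | apply: changes_only_sub o2];
by move=> i hi; apply: (h i); rewrite mem_cat hi ?orbT.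
Qed.

Definition add_window :=
  prod_skipping ;; multiply racc rc rw ;; Add rout rout racc.

Definition cost_add_window S := cost_prod_skipping S + 3 * S + 8.

Lemma runs_add_window S s : s rone = 1 -> s rN + s rL = S -> s rc <= S.+1 ->
  runs add_window (cost_add_window S) s
    (fun s' => s' rout = s rout + s rc * skipfact S (s rd) /\
               changes_only [:: rout; rw; ri; rt1; rt2; racc; rctr] s s').
Proof.
move=> one sS cS; eapply runs_weaken; last by move=> s' h; exact: h.
  exec_step; eapply runs_call; first exact: (runs_prod_skipping one sS).
  move=> s1 [e1 o1]; exec_step; eapply runs_call.
    by apply: (@runs_multiply _ _ _ S.+1); rewrite // ?(o1 rone) // (o1 rc).
  move=> s2 [e2 o2]; exec_step; split.
    by rewrite updE (o2 rout) // (o1 rout) // e2 (o1 rc) // e1.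
  by frame; exact: (changes_only_seq o1 o2).
rewrite /cost_add_window; lia.
Qed.

Definition fetch u i j :=
  Add raddr i j ;; Add raddr raddr raddr ;; Add raddr raddr rone ;;
  Read u raddr.

Lemma runs_fetch x u i j s : s rone = 1 -> holds_word x s ->
  runs (fetch u i j) 4 s
    (fun s' => s' u = x (s i + s j) /\ changes_only [:: raddr; u] s s').
Proof.
move=> one hx.
apply: (@runs_weaken _ (1 + (1 + (1 + 1))) _ _ _ _ _ (leqnn _) (fun _ h => h)).
do 7 exec_step; split.
  rewrite !updE ![upd _ raddr _ rone]upd_ne // one addn1 addnn -hx.
  by rewrite !upd_ne //; lia.
by apply: changes_only_upd; [rewrite !inE eqxx orbT | frame].
Qed.

Definition matches (x : nat -> nat) m i j :=
  all (fun t => x (i + t) == x (j + t)) (iota 0 m).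

(** Cell re sums up the distances between the letters from position rs on and those
    from position rlast on; it ends at 0 exactly if the contexts agree. *)
Definition compare_contexts :=
  Const re 0 ;; copy ri rm ;;
  While ri (dec ri ;; fetch ru rs ri ;; fetch rv rlast ri ;;
            Minus rt1 ru rv ;; Minus rt2 rv ru ;; Add rt1 rt1 rt2 ;;
            Add re re rt1).

Lemma runs_compare_contexts x M s : s rone = 1 -> holds_word x s -> s rm <= M ->
  runs compare_contexts (14 * M + 4) s
    (fun s' => (s' re == 0) = matches x (s rm) (s rs) (s rlast) /\
               changes_only [:: re; ri; rt1; rt2; raddr; ru; rv] s s').
Proof.
move=> one hx mM; set L := (L in changes_only L).
pose ok t := x (s rs + t) == x (s rlast + t).
pose I j s' := [/\ s' ri = j, (s' re == 0) = all ok (iota j (s rm - j)),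
  j <= s rm & changes_only L s s'].
eapply runs_weaken.
- do 6 exec_step.
  apply: (@runs_while _ _ _ M I); first by move=> j s2 [].
  + move=> j s2 jS [i1 i2 i3 i4].
    do 3 exec_step; eapply runs_call.
      apply: (@runs_fetch x); first by rewrite /upd /= i4.
      by apply: (@changes_only_word L _ s) hx => //; frame.
    move=> s3 [e3 o3].
    have o3' : changes_only L s s3.
      by apply: (changes_only_seq (L1 := L) _ o3) => //; frame.
    exec_step; eapply runs_call.
      apply: (@runs_fetch x); first by rewrite (o3' rone).
      by apply: changes_only_word hx; last exact: o3'.
    move=> s4 [e4 o4].
    have o4' : changes_only L s s4.
      by apply: (changes_only_seq o3' o4).
    do 7 exec_step; split.
    * by rewrite /upd /= (o4 ri) // (o3 ri) // /upd /= i1 i4 // one subn1.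
    * rewrite /upd /= (o4 ru) // e3 e4 (o3 ri) // (o3 rlast) //.
      rewrite (o4 re) // (o3 re) // /upd /= i1 (i4 rone) // (i4 rs) // (i4 rlast) // one subn1 /=.
      have -> : s rm - j = (s rm - j.+1).+1 by lia.
      rewrite /= -i2 /ok addn_eq0 addn_eq0 !subn_eq0 -eqn_leq andbC //.
    * lia.
    * by frame.
  + by rewrite /upd /=.
  + split; rewrite /upd //=.
    * by rewrite subnn.
    * by frame.
- lia.
- move=> s' [i1 i2 i3 i4]; split=> //.
  by rewrite i2 subn0.
Qed.

(** Extends the window by the position rs: rd holds the number of matches plus l,
    rc the number of occurrences of the letter ra plus 1. *)
Definition update_counts :=
  compare_contexts ;;
  Ifz re
    (Add rd rd rone ;; fetch ru rs rm ;;
     Minus rt1 ru ra ;; Minus rt2 ra ru ;; Add rt1 rt1 rt2 ;;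
     Ifz rt1 (Add rc rc rone) (Const rt1 0))
    (Const rt1 0).

Lemma runs_update_counts x M s : s rone = 1 -> holds_word x s -> s rm <= M ->
  runs update_counts (14 * M + 20) s
    (fun s' => [/\ s' rd = matches x (s rm) (s rs) (s rlast) + s rd,
       s' rc = (matches x (s rm) (s rs) (s rlast) && (x (s rs + s rm) == s ra)) + s rc
      & changes_only [:: rd; rc; re; ri; rt1; rt2; raddr; ru; rv] s s']).
Proof.
move=> one hx mM; set L := (L in changes_only L).
eapply runs_weaken.
- exec_step; eapply runs_call; first exact: (runs_compare_contexts one hx mM).
  move=> s1 [e1 o1].
  have o1' : changes_only L s s1 by apply: changes_only_sub o1 => i; rewrite !inE => ->; rewrite !orbT.
  eapply (@runs_ifz _ _ _ _ _ _ (fun s' => [/\ s' rd = matches x (s rm) (s rs) (s rlast) + s rd,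
       s' rc = (matches x (s rm) (s rs) (s rlast) && (x (s rs + s rm) == s ra)) + s rc
      & changes_only L s s'])); rewrite -e1 => e; last first.
    exec_step; split; rewrite /upd /= ?(introF eqP e) ?(o1 rd) ?(o1 rc) //.
    by frame.
  rewrite e; do 3 exec_step; eapply runs_call.
    apply: (@runs_fetch x); first by rewrite /upd /= (o1 rone).
    by apply: (@changes_only_word L _ s) hx => //; frame.
  move=> s2 [e2 o2].
  have o2' : changes_only L s s2.
    by apply: (changes_only_seq (L1 := L) _ o2) => //; frame.
  do 6 exec_step.
  have hc : s2 rc = s rc by rewrite (o2 rc) // /upd /= (o1 rc).
  have hd : s2 rd = (s rd).+1 by rewrite (o2 rd) // /upd /= !(o1 rd, o1 rone) // one addn1.
  have hu : s2 ru = x (s rs + s rm) by rewrite e2 /upd /= !o1.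
  have ha : s2 ra = s ra by rewrite (o2 ra) // /upd /= o1.
  eapply (@runs_ifz _ _ _ _ _ _); rewrite /upd /= => e';
    exec_step; split; rewrite /upd /=; try (by frame); rewrite ?hd //;
    rewrite hc hu ha in e' *.
    rewrite (o2' rone) // one; case: eqP => ? /=; lia.
  case: eqP => ? /=; lia.
- lia.
- by [].
Qed.

Definition match_count x m N s := \sum_(s <= t < N) matches x m t N.

Definition symbol_count x m N a s :=
  \sum_(s <= t < N) (matches x m t N && (x (t + m) == a)).

(** The partial sum over the windows that start at j or later, the invariant of
    the loop that moves the start of the window from N down to 0. *)
Definition numerator S l x m N a j :=
  \sum_(j <= s < N.+1) (symbol_count x m N a s).+1 * skipfact S (match_count x m N s + l).

Lemma numeratorS S l x m N a j : j <= N ->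
  numerator S l x m N a j.+1 + (symbol_count x m N a j).+1 * skipfact S (match_count x m N j + l) =
  numerator S l x m N a j.
Proof. by move=> jN; rewrite addnC /numerator [RHS]big_ltn. Qed.

Lemma symbol_count_le x m N a s : symbol_count x m N a s <= N.
Proof.
apply: (@leq_trans (\sum_(s <= t < N) 1)); first by apply: leq_sum => i _; exact: leq_b1.
by rewrite sum_nat_const_nat muln1 leq_subr.
Qed.

Definition compute_numerator :=
  Const rc 1 ;; copy rd rL ;; Const rout 0 ;; add_window ;; copy rs rlast ;;
  While rs (dec rs ;; update_counts ;; add_window).

Definition cost_numerator S := S * (cost_add_window S + 14 * S + 22) + cost_add_window S + 8.

Lemma runs_compute_numerator x S s : s rone = 1 -> holds_word x s -> s rN + s rL = S ->
  s rm <= S -> s rlast <= S ->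
  runs compute_numerator (cost_numerator S) s
    (fun s' => s' rout = numerator S (s rL) x (s rm) (s rlast) (s ra) 0 /\
     changes_only [:: rc; rd; rout; rs; rw; ri; rt1; rt2; racc; rctr; re; raddr; ru; rv]
       s s').
Proof.
move=> one hx sS mS NS; set L := (L in changes_only L).
set m := s rm; set N := s rlast; set a := s ra; set l := s rL.
pose I j s' := [/\ s' rs = j, j <= N,
  [/\ s' rd = match_count x m N j + l, s' rc = (symbol_count x m N a j).+1
    & s' rout = numerator S l x m N a j] & changes_only L s s'].
eapply runs_weaken.
- do 9 exec_step; eapply runs_call.
    by apply: (@runs_add_window S); rewrite /upd.
  move=> s1; rewrite /upd /= !add0n => -[e1 o1].
  do 4 exec_step.
  have o1' : changes_only L s s1 by apply: (changes_only_seq (L1 := L) _ o1) => //; frame.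
  apply: (@runs_while _ _ _ S I); first by move=> j s2 [].
  + move=> j s2 jS [i1 i2 [i3 i4 i5] i6].
    do 3 exec_step; eapply runs_call.
      apply: (@runs_update_counts x S); rewrite /upd //= ?(i6 rone) ?(i6 rm) //.
      by apply: (@changes_only_word L _ s) hx => //; frame.
    move=> s3; rewrite /upd /= => -[e3 e3' o3].
    have o3' : changes_only L s s3 by apply: (changes_only_seq (L1 := L) _ o3) => //; frame.
    rewrite !(i6 rone, i6 rm, i6 rlast, i6 ra) // i1 one subn1 /= -/m -/N -/a in e3 e3'.
    have hd : s3 rd = match_count x m N j + l.
      by rewrite e3 i3 /match_count [in RHS]big_ltn // addnA.
    have hc : s3 rc = (symbol_count x m N a j).+1.
      by rewrite e3' i4 /symbol_count [in RHS]big_ltn // addnS.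
    eapply runs_call.
      apply: (@runs_add_window S); rewrite ?(o3' rone) ?(o3' rN) ?(o3' rL) //.
      by rewrite hc; have := symbol_count_le x m N a j; lia.
    move=> s4 [e4 o4]; split.
    * by rewrite (o4 rs) // (o3 rs) //= i1 i6 // one subn1.
    * lia.
    * split; first by rewrite (o4 rd).
        by rewrite (o4 rc).
      rewrite e4 hc hd (o3 rout); last by [].
      by rewrite /= i5; apply: numeratorS; lia.
    * exact: (changes_only_seq o3' o4).
  + by rewrite /upd /= (o1 rlast).
  + rewrite /upd /= (o1 rlast) //=; split=> //.
    * split; rewrite ?(o1 rd) ?(o1 rc) //= ?e1.
      - by rewrite /match_count big_geq.
      - by rewrite /symbol_count big_geq.
      - by rewrite /numerator big_nat1 /match_count /symbol_count !big_geq // mul1n.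
    * by frame.
- rewrite /cost_numerator /=; nia.
- by move=> s' [_ _ [_ _ ->]].
Qed.

Definition compute_numerators :=
  copy ra rL ;;
  While ra (dec ra ;; compute_numerator ;; Add raddr ra ra ;; Const rt1 64 ;;
            Add raddr raddr rt1 ;; Write raddr rout).

Lemma runs_compute_numerators x S s : s rone = 1 -> holds_word x s -> s rN + s rL = S ->
  s rm <= S -> s rlast <= S ->
  runs compute_numerators (S * (cost_numerator S + 6) + 3) s
    (fun s' =>
      (forall a, a < s rL ->
         s' (64 + a.*2) = numerator S (s rL) x (s rm) (s rlast) a 0) /\
      [/\ s' rone = 1, s' rN = s rN, s' rL = s rL & s' rlast = s rlast]).
Proof.
move=> one hx sS mS NS.
set L := [:: ra; rc; rd; rout; rs; rw; ri; rt1; rt2; racc; rctr; re; raddr; ru; rv].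
pose I j s' := [/\ s' ra = j,
   forall a, j <= a -> a < s rL ->
     s' (64 + a.*2) = numerator S (s rL) x (s rm) (s rlast) a 0,
   holds_word x s' & forall i, i < 64 -> ~~ odd i -> i \notin L -> s' i = s i].
eapply runs_weaken.
- do 4 exec_step.
  apply: (@runs_while _ _ _ S I); first by move=> j s2 [].
  + move=> j s2 jS [i1 i2 i3 i4].
    do 3 exec_step; eapply runs_call.
      apply: (@runs_compute_numerator x S); last 3 first;
        try by rewrite /upd /= ?(i4 rN) ?(i4 rL) ?(i4 rm) ?(i4 rlast) ?(i4 rone).
      by apply: (@changes_only_word L _ s2) i3 => //; frame.
    move=> s3; rewrite /upd /= => -[e3 o3].
    have o3' : changes_only L s2 s3 by apply: (changes_only_seq (L1 := L) _ o3) => //; frame.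
    rewrite (i4 rL) // (i4 rm) // (i4 rlast) // (i4 rone) // i1 one subn1 /= in e3.
    have a3 : s3 ra = j by rewrite (o3 ra) //= i1 (i4 rone) // one subn1.
    do 7 exec_step.
    set s5 := upd _ raddr _.
    have o5 : changes_only L s2 s5 by frame.
    have w5 : s5 raddr = 64 + j.*2 by rewrite /s5 /upd /= a3 addnn addnC.
    have r5 : s5 rout = numerator S (s rL) x (s rm) (s rlast) j 0 by [].
    rewrite w5 r5; split.
    * by rewrite upd_ne //; lia.
    * move=> a ja al; have [->|ne] := eqVneq a j; first by rewrite updE.
      rewrite upd_ne; last by lia.
      rewrite o5 ?i2 //; lia.
    * move=> i; rewrite upd_ne; last by lia.
      by rewrite -i3 (o5 _) // !inE; lia.
    * move=> i i64 oi iL; rewrite upd_ne ?o5 ?i4 //; lia.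
  + by rewrite /upd /=; lia.
  + split; rewrite /upd //=.
    * by move=> a; rewrite add0n; lia.
    * by apply: (@changes_only_word L _ s) hx => //; frame.
    * by move=> i i64 oi; rewrite !inE !negb_or => /andP[/negbTE-> _].
- by lia.
- move=> s' [_ i2 _ i4]; split=> [a|]; first exact: i2.
  by split; rewrite i4.
Qed.

(** For n > 0 the largest m with l^(2m) <= n, which keeps the number l^m of
    contexts at most the square root of the number of observations. *)
Definition context_length n l := trunc_log (l * l) n.

Lemma context_length_le n l : 1 < l -> context_length n l <= n.
Proof.
move=> l1; case: n => [|n]; first by rewrite /context_length trunc_log0.
have B1 : 1 < l * l by nia.
apply/ltnW/(leq_trans (ltn_expl _ B1)); exact: trunc_logP.
Qed.

(** The number of rounds is fixed to n: once rp * rB exceeds n the rounds change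
    nothing, and n rounds are enough since (l * l)^n > n. *)
Definition choose_context_length :=
  multiply rB rL rL ;; Const rp 1 ;; Const rm 0 ;; copy rs rN ;;
  While rs (dec rs ;; multiply racc rp rB ;; Minus rt1 racc rN ;;
            Ifz rt1 (copy rp racc ;; Add rm rm rone) (Const rt1 0)) ;;
  Minus rlast rN rm.

Lemma runs_choose_context_length S s : s rone = 1 -> 1 < s rL -> s rN + s rL = S ->
  runs choose_context_length (S * (3 * S + 13) + 3 * S + 12) s
    (fun s' => [/\ s' rm = context_length (s rN) (s rL), s' rlast = s rN - s' rm
     & changes_only [:: rB; rp; rm; rs; racc; rt1; rlast; rctr] s s']).
Proof.
move=> one l1 sS; set L := (L in changes_only L).
set n := s rN; set l := s rL; have B1 : 1 < l * l by rewrite /l; nia.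
pose I j s' := [/\ s' rs = j, j <= n, s' rp = (l * l) ^ s' rm,
   [/\ s' rp <= maxn 1 n, s' rm <= n & n - j <= s' rm \/ n < (l * l) ^ (s' rm).+1]
   & s' rB = l * l /\ changes_only L s s'].
eapply runs_weaken; last by move=> s' h; exact: h.
- exec_step; eapply runs_call; first by apply: (@runs_multiply _ _ _ S); rewrite //; lia.
  move=> s1 [e1 o1]; do 8 exec_step.
  have o1' : changes_only L s s1 by apply: changes_only_sub o1 => i; rewrite !inE => /orP[]/eqP->.
  exec_step; eapply runs_call.
    apply: (@runs_while _ _ _ S I); first by move=> j s2 [].
    + move=> j s2 jS [i1 i2 i3 [i4 i5 i6] [i7 i8]].
      do 3 exec_step; eapply runs_call.
        apply: (@runs_multiply _ _ _ S); rewrite /upd //= ?(i8 rone) //.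
        by move: i4 jS; rewrite /n; lia.
      move=> s3; rewrite /upd /= => -[e3 o3].
      have o3' : changes_only L s s3 by apply: (changes_only_seq (L1 := L) _ o3) => //; frame.
      do 2 exec_step.
      have p3 : s3 rp = s2 rp by rewrite (o3 rp).
      have m3 : s3 rm = s2 rm by rewrite (o3 rm).
      have B3 : s3 rB = l * l by rewrite (o3 rB).
      have j3 : s3 rs = j by rewrite (o3 rs) //= i1 (i8 rone) // one subn1.
      have n3 : s3 rN = n by rewrite (o3' rN).
      have h3 : s3 rone = 1 by rewrite (o3' rone).
      rewrite i7 i3 -expnSr in e3.
      apply: runs_ifz; rewrite updE n3 e3 => ht.
        do 5 exec_step.
        rewrite /I /upd /= j3 m3 h3 e3 add0n addn1; split=> //.
        * lia.
        * have nn : (l * l) ^ (s2 rm).+1 <= n by lia.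
          have mn : (s2 rm).+1 <= n.
            by apply: leq_trans nn; apply: ltnW; apply: ltn_expl.
          split=> //; first by rewrite leq_max nn orbT.
          by case: i6 => [|?]; [left; lia | lia].
        * by split=> //; frame.
      exec_step.
      rewrite /I /upd /= j3 m3 p3; split=> //.
      * lia.
      * split=> //; right; lia.
      * by split=> //; frame.
    + by rewrite /upd /= (o1 rN) //; lia.
    + rewrite /I /upd /= (o1 rN) //; split=> //.
      * by split=> //; [rewrite leq_max | left; lia].
      * by split=> //; frame.
  move=> s2 [_ _ i3 [i4 i5 i6] [_ i8]]; exec_step.
  rewrite /upd /=; split.
  + have lt : n < (l * l) ^ (s2 rm).+1.
      case: i6 => // h; apply: leq_trans (ltn_expl _ B1) _.
      by rewrite leq_pexp2l //; lia.
    rewrite /context_length; case: (posnP n) => [n0|n0].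
      have -> : s2 rm = 0 by lia.
      by rewrite n0 trunc_log0.
    apply: esym; apply: trunc_log_eq => //; rewrite lt andbT -i3.
    by apply: leq_trans i4 _; lia.
  + by rewrite (i8 rN).
  + by frame.
- by nia.
Qed.

(** With 0 as the factor to leave out, [prod_skipping] computes (n + l)!.  The last
    loop moves the numerators from the buffer to the odd cells. *)
Definition estimate_prog :=
  Const rone 1 ;; choose_context_length ;; compute_numerators ;; Const rd 0 ;; prod_skipping ;;
  Add rt1 rlast rone ;; multiply racc rt1 rw ;; copy rN racc ;; copy ra rL ;;
  While ra (dec ra ;; Add raddr ra ra ;; Const rt1 64 ;; Add rt2 raddr rt1 ;;
            Read ru rt2 ;; Add raddr raddr rone ;; Write raddr ru).

Definition cost_estimate S :=
  S * (3 * S + 13) + S * (cost_numerator S + 6) + cost_prod_skipping S + 14 * S + 60.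

Definition denominator S N := N.+1 * S`!.

Lemma runs_estimate_prog x n l s : 1 < l ->
  s rN = n -> s rL = l -> holds_word x s ->
  runs estimate_prog (cost_estimate (n + l)) s
    (fun s' => let m := context_length n l in
      s' 0 = denominator (n + l) (n - m) /\
      forall a, a < l -> s' a.*2.+1 = numerator (n + l) l x m (n - m) a 0).
Proof.
move=> l1 sN sL hx; set S := n + l; set m := context_length n l; set N := n - m.
have mn : m <= n by exact: context_length_le.
eapply runs_weaken.
- do 3 exec_step; eapply runs_call.
    by apply: (@runs_choose_context_length S); rewrite /upd //= ?sN ?sL.
  move=> s1; rewrite /upd /= sN sL -/m => -[m1 N1 o1].
  rewrite m1 -/N in N1.
  have h1 : s1 rone = 1 by rewrite o1.
  have n1 : s1 rN = n by rewrite o1.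
  have l1' : s1 rL = l by rewrite o1.
  have x1 : holds_word x s1.
    move=> j; rewrite o1 /=; first by case: eqP => // ?; lia.
    by rewrite !inE; lia.
  exec_step; eapply runs_call.
    by apply: (@runs_compute_numerators x S); rewrite ?n1 ?l1' ?m1 ?N1 //; lia.
  move=> s2 [e2 [h2 n2 l2 N2]];
  rewrite l1' m1 N1 in e2; rewrite n1 in n2; rewrite l1' in l2; rewrite N1 in N2.
  do 3 exec_step; eapply runs_call.
    by apply: (@runs_prod_skipping S); rewrite /upd //= n2 l2.
  move=> s3; rewrite /upd /= skipfact0 => -[w3 o3].
  do 3 exec_step; eapply runs_call.
    apply: (@runs_multiply _ _ _ S.+1); rewrite /upd //= ?(o3 rone) ?(o3 rlast) //= N2 h2; lia.
  move=> s4; rewrite /upd /= => -[d4 o4]; rewrite w3 (o3 rlast) // (o3 rone) //= N2 h2 addn1 in d4.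
  set L := [:: rd; rw; ri; rt1; rt2; racc; rctr].
  have o4' : changes_only L s2 s4.
    apply: (@changes_only_trans _ _ s3).
      by apply: (changes_only_seq (L1 := L) _ o3) => //; frame.
    by apply: (changes_only_seq (L1 := L) _ o4) => //; frame.
  do 8 exec_step.
  pose I j s' := [/\ s' ra = j, s' 0 = denominator S N,
     forall a, a < l -> s' (64 + a.*2) = numerator S l x m N a 0,
     forall a, j <= a -> a < l -> s' a.*2.+1 = numerator S l x m N a 0
   & s' rone = 1 /\ j <= l].
  apply: (@runs_while _ _ _ S I); first by move=> j s' [].
  + move=> j s' jS [i1 i2 i3 i4 [i5 jl]].
    do 13 exec_step.
    set s6 := upd _ ru _; set s7 := upd s6 raddr _.
    have u7 : s7 ru = numerator S l x m N j 0.
      by rewrite /s7 /s6 /upd /= i1 i5 subn1 /= -i3 // addnn addnC.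
    have w7 : s7 raddr = j.*2.+1.
      by rewrite /s7 /s6 /upd /= i1 i5 subn1 /= addnn addn1.
    have a7 : s7 ra = j by rewrite /s7 /s6 /upd /= i1 i5 subn1.
    have o7 : changes_only [:: ra; raddr; rt1; rt2; ru] s' s7 by frame.
    rewrite u7 w7; split.
    * by rewrite upd_ne //; lia.
    * by rewrite upd_ne //; lia.
    * move=> a al; rewrite upd_ne; last lia.
      by rewrite o7 ?i3 // !inE; lia.
    * move=> a ja al; have [->|ne] := eqVneq a j; first by rewrite updE.
      rewrite upd_ne; last by lia.
      rewrite o7 ?i4 //; first by lia.
      by rewrite !inE; lia.
    * by split; [rewrite upd_ne; [rewrite o7 | lia] | lia].
  + by rewrite /upd /= (o4' rL) // l2; lia.
  + have hL : s4 rL = l by rewrite (o4' rL).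
    rewrite /upd /= hL add0n; split=> //=.
    * by move=> a al; rewrite -e2 // o4'.
    * by move=> a; lia.
    * by split=> //; rewrite (o4' rone).
- rewrite /cost_estimate /=; nia.
- by move=> s' [_ i2 _ i4 _]; split=> // a al; rewrite i4.
Qed.

End Machine.

(** * The predictor *)

Definition letters (l : nat) (x : seq 'I_l) : nat -> nat :=
  nth 0%N (map (@nat_of_ord l) x).

Lemma match_count_le y m N s : (match_count y m N s <= N)%N.
Proof.
apply: (@leq_trans (\sum_(s <= t < N) 1)%N); first by apply: leq_sum => i _; exact: leq_b1.
by rewrite sum_nat_const_nat muln1 leq_subr.
Qed.

Lemma sum_symbol_count l (x : seq 'I_l) m N s : (m + N)%N = size x ->
  (\sum_(a < l) symbol_count (letters x) m N a s)%N = match_count (letters x) m N s.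
Proof.
move=> sx; rewrite exchange_big /=; rewrite /match_count [RHS]big_nat_cond [LHS]big_nat_cond.
apply: eq_bigr => t; rewrite andbT => /andP[_ tN].
have tx : (t + m < size x)%N by lia.
case: (matches _ _ _ _) => /=; last by rewrite big1.
case: x sx tx => [|a0 x] // sx tx.
rewrite (bigD1 (nth a0 (a0 :: x) (t + m))) //= /letters (nth_map a0) // eqxx.
rewrite big1 // => a ne; case: eqP => // e; case/eqP: ne.
by apply/esym/val_inj; exact: e.
Qed.

(** For each window the smoothed counts add up to the factor d that [skipfact]
    leaves out of the factorial. *)
Lemma sum_numerator l (x : seq 'I_l) m N : (0 < l)%N -> (m + N)%N = size x ->
  (\sum_(a < l) numerator (size x + l) l (letters x) m N a 0)%N = denominator (size x + l) N.
Proof.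
move=> l0 sx; rewrite exchange_big /=.
rewrite (eq_bigr (fun=> (size x + l)`!)) => [|s _].
  by rewrite sum_nat_const_nat subn0.
rewrite -big_distrl /=.
under eq_bigr do rewrite -addn1.
rewrite big_split /= sum_symbol_count // sum1_card card_ord skipfactE //.
have := match_count_le (letters x) m N s; lia.
Qed.

Lemma skipfact_gt0 S d : (0 < skipfact S d)%N.
Proof.
rewrite /skipfact big_seq_cond.
by apply: prodn_cond_gt0 => i; rewrite mem_index_iota => /andP[/andP[]].
Qed.

Lemma count_grams (A : finType) (a0 : A) m (w : seq A) (P : pred (m.-tuple A * A)) s N :
  count P (grams a0 m (drop s w) (N - s)) =
  (\sum_(s <= t < N) P (gram a0 m w t))%N.
Proof.
rewrite /grams count_map count_rev -sum1_count big_mkcond /=.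
rewrite -[in RHS](add0n s) big_addn /index_iota subn0; apply: eq_bigr => j _.
by rewrite gram_drop addnC; case: (P _).
Qed.

Section Connect.
Variables (R : realType) (l : nat) (x : seq 'I_l) (a a0 : 'I_l) (m N : nat).
Hypothesis sx : (m + N)%N = size x.
Let w := rcons x a.

Let lettersE j : (j < size x)%N -> letters x j = nth a0 x j.
Proof. by move=> jx; rewrite /letters (nth_map a0). Qed.

Let wE j : (j < size x)%N -> nth a0 w j = nth a0 x j.
Proof. by move=> jx; rewrite /w nth_rcons jx. Qed.

Let context_eq t : (t < N)%N ->
  (context a0 m w t == context a0 m w N) = matches (letters x) m t N.
Proof.
move=> tN; apply/eqP/allP => [e i|h].
  rewrite mem_iota /= => im; apply/eqP; rewrite !lettersE; try lia.
  have := congr1 (fun c => tnth c (Ordinal im)) e; rewrite !tnth_mktuple /=.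
  by rewrite !wE; [move=> -> | lia | lia].
apply: eq_mktuple => i; have im := ltn_ord i.
have := h i; rewrite mem_iota /= => /(_ im) /eqP; rewrite !lettersE; try lia.
by rewrite !wE; [exact: val_inj | lia | lia].
Qed.

Let last_letter : nth a0 w (N + m) = a.
Proof. by rewrite /w nth_rcons addnC sx ltnn eqxx. Qed.

(** What the program computes is the averaged predictor; appending any letter a
    to x leaves the context and the earlier grams unchanged. *)
Lemma numerator_averaged :
  (numerator (size x + l) l (letters x) m N a 0)%:R / (denominator (size x + l) N)%:R =
  averaged R a0 m N w.
Proof.
set S := (size x + l)%N.
have l0 : (0 < l)%N by case: (l) a => [[]|].
have S0 : S`!%:R != 0 :> R by rewrite pnatr_eq0 -lt0n fact_gt0.
rewrite /averaged /denominator natrM invfM mulrCA; congr (_ * _).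
rewrite /numerator natr_sum mulr_suml big_mkord; apply: eq_bigr => s _.
rewrite /step_at /laplace_step gram_drop subnKC; last by have := ltn_ord s.
have -> : ctx_count (grams a0 m (drop s w) (N - s)) (gram a0 m w N).1 =
    match_count (letters x) m N s.
  rewrite /ctx_count count_grams /match_count [LHS]big_nat_cond [RHS]big_nat_cond.
  by apply: eq_bigr => t /andP[/andP[_ tN] _]; rewrite /= context_eq.
have -> : count_mem (gram a0 m w N) (grams a0 m (drop s w) (N - s)) =
    symbol_count (letters x) m N a s.
  rewrite count_grams /symbol_count [LHS]big_nat_cond [RHS]big_nat_cond.
  apply: eq_bigr => t /andP[/andP[_ tN] _].
  rewrite /= xpair_eqE context_eq // last_letter; congr (nat_of_bool (_ && _)).
  by rewrite wE ?lettersE; try lia.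
rewrite card_ord natrM.
have d0 : (0 < match_count (letters x) m N s + l)%N by lia.
have := @skipfactE S (match_count (letters x) m N s + l).
rewrite d0 /= => /(_ _) <-; last by have := match_count_le (letters x) m N s; rewrite /S; lia.
set d := (match_count _ _ _ _ + l)%N in d0 *; rewrite natrM.
have sk0 := skipfact_gt0 S d.
by field; rewrite !pnatr_eq0 -!lt0n d0 sk0.
Qed.

End Connect.

Section Risk.
Variables (R : realType).

Definition predictor (l n : nat) (x : n.-tuple 'I_l) (a : 'I_l) : R :=
  let N := (n - context_length n l)%N in
  (numerator (n + l) l (letters x) (context_length n l) N a 0)%:R / (denominator (n + l) N)%:R.

Lemma predictor_averaged (l n : nat) (a0 : 'I_l) (x : n.-tuple 'I_l) a :
  (1 < l)%N ->
  predictor x a = averaged R a0 (context_length n l) (n - context_length n l) (rcons x a).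
Proof.
move=> l1; rewrite -numerator_averaged size_tuple //.
by rewrite subnKC // context_length_le.
Qed.

Lemma predictor_estimator (l n : nat) : (1 < l)%N -> is_estimator (@predictor l n).
Proof.
move=> l1 x; split=> [a|]; first by rewrite divr_ge0.
rewrite -mulr_suml -natr_sum; have mn := context_length_le n l1.
have := @sum_numerator l x (context_length n l) (n - context_length n l).
rewrite size_tuple => ->; [|lia|lia].
rewrite divff // pnatr_eq0 -lt0n /denominator muln_gt0 fact_gt0 //.
Qed.

(** Words of probability 0 contribute to neither side, and q > 0 keeps the
    divergence finite. *)
Lemma expected_KLE (l n : nat) (p : seq 'I_l -> R) (P : n.+1.-tuple 'I_l -> R)
    (Q : n.-tuple 'I_l -> 'I_l -> R) (q : seq 'I_l -> R) :
  stationary_process p -> (forall w : n.+1.-tuple 'I_l, P w = p w) ->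
  (forall x a, Q x a = q (rcons x a)) -> (forall w, 0 < q w) ->
  expected_KL P Q =
    (expect p n.+1 (fun w => ln (p w) - ln (p (take n w)) - ln (q w)))%:E.
Proof.
move=> hp PE QE q0.
have past x : past_law P x = p x.
  by rewrite -(process_rcons hp); apply: eq_bigr => a _; rewrite PE.
pose F w := p w * (ln (p w) - ln (p (take n w)) - ln (q w)).
rewrite /expected_KL /expect (sum_words_rcons _ F) -sumEFin.
apply: eq_bigr => x _; rewrite /KL ifT; last first.
  by apply/forallP => a; apply/implyP; rewrite QE gt_eqF.
rewrite -EFinM past; congr (_%:E); rewrite mulr_sumr; apply: eq_bigr => a _.
rewrite /cond_law past PE QE /F /=.
rewrite -[rcons x a as w in p (take n w)]cats1 take_size_cat ?size_tuple //.
have := process_ge0 hp (rcons x a); rewrite le_eqVlt => /orP[/eqP<-|pxa].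
  by rewrite !mul0r mulr0.
have px : 0 < p x by apply: (process_prefix hp (v := [:: a])); rewrite cats1.
rewrite ln_div ?posrE ?divr_gt0 // ln_div ?posrE //.
by field; rewrite gt_eqF.
Qed.

Lemma predictor_risk (k l n m : nat) : (0 < k)%N -> (1 < l)%N ->
  context_length n l = m ->
  (risk (@predictor l n) (@hmm_class R k l n) <=
    (ln k%:R / m.+1%:R +
     (l * l ^ m)%:R * ln ((n - m).+1 + l)%:R / (n - m).+1%:R)%:E)%E.
Proof.
move=> k0 l1 mE; apply: ge_ereal_sup => _ [P [pi [M [T [hM hT hpi ->]]]] <-].
have l0 : (0 < l)%N by lia.
pose a0 := Ordinal l0; have mn : (m <= n)%N by rewrite -mE context_length_le.
have hp := hmm_process hM hT hpi.
rewrite (expected_KLE (q := averaged R a0 m (n - m)) hp) => [|w|x a|w]; last 3 first.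
- exact: hmm_lawE.
- by rewrite -mE; exact: predictor_averaged.
- exact: averaged_gt0.
rewrite lee_fin; have := redundancy_bound a0 m hp (n - m).
rewrite subnKC // card_ord => /le_trans; apply; rewrite lerD2r.
by rewrite ler_pdivlMr ?ltr0n // mulrC; exact: hmm_mixture.
Qed.

End Risk.

(** * Asymptotics *)

Lemma input_word (k l n : nat) (x : n.-tuple 'I_l) : holds_word (letters x) (input k x).
Proof. by move=> j; rewrite /input /= odd_double uphalf_double. Qed.

Lemma cost_estimate_le S : (cost_estimate S <= 300 * S.+1 ^ 4)%N.
Proof.
rewrite /cost_estimate /cost_numerator /cost_add_window /cost_prod_skipping !expnS expn0 muln1.
have -> : S.+1 = (S + 1)%N by lia.
nia.
Qed.

(** The time is polynomial in n + l n; the constant b absorbs the finitely many n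
    with l n > n. *)
Lemma polytime_predictor (R : realType) (k l : nat -> nat) b :
  (forall n, 1 < l n)%N -> (forall n, l n <= n + b)%N ->
  polytime_computable k (fun n => @predictor R (l n) n).
Proof.
move=> l1 lb; exists estimate_prog, (300 * (b + 3) ^ 4)%N, 4%N => n x.
have := @runs_estimate_prog (letters x) n (l n) (input (k n) x) (l1 n) erefl erefl
  (input_word (k n) x).
move=> [t [s [ex tc [den num]]]]; exists t, s; split=> //.
  apply: leq_trans tc _; apply: leq_trans (cost_estimate_le _) _.
  rewrite -mulnA -expnMn -mulnDr leq_mul2l /=.
  have := lb n; case: n {x ex den num} => [|n] ln.
    by rewrite muln0 exp0n // add0n leq_exp2r //; lia.
  by apply: leq_trans (leq_addr _ _); rewrite leq_exp2r //; nia.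
split=> [|a]; first by rewrite den /denominator; apply/eqP; rewrite muln_eq0 -lt0n fact_gt0.
by rewrite /predictor -num ?ltn_ord // -den.
Qed.

(** With X = l^(m+1), the choice of m and l^4 <= n give X^4 <= n^3, while
    n - m + 1 >= n / 2; so X ln (n + l) ln n / (n - m + 1) is at most a constant
    times n^(-1/4) (ln n)^2, bounded since y <= exp y at y = ln n / 8. *)
Lemma sample_term_le (R : realType) (l n m : nat) : (1 < l)%N -> (l ^ 4 <= n)%N ->
  context_length n l = m ->
  (l * l ^ m)%:R * ln ((n - m).+1 + l)%:R / (n - m).+1%:R <= 256 / ln n%:R :> R.
Proof.
move=> l1 ln4 mE; have n0 : (0 < n)%N by apply: leq_trans ln4; rewrite expn_gt0; lia.
have ln_n : (l <= n)%N by apply: leq_trans ln4; rewrite -{1}(expn1 l) leq_pexp2l //; lia.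
have n2 : (1 < n)%N by lia.
have Bm : ((l * l) ^ m <= n)%N by rewrite -mE trunc_logP //; nia.
have m2 : (2 * m <= n)%N.
  apply: leq_trans Bm; apply: (@leq_trans ((2 * 2) ^ m)).
    by rewrite expnMn -expnD addnn -mul2n ltnW // ltn_expl.
  by case: m {mE} => // m; rewrite leq_exp2r //; nia.
set X := (l * l ^ m)%N.
have X4 : (X ^ 4 <= n ^ 3)%N.
  rewrite /X expnMn (_ : n ^ 3 = n * n ^ 2)%N // leq_mul //.
  rewrite (_ : (l ^ m) ^ 4 = ((l * l) ^ m) ^ 2)%N; first by rewrite leq_exp2r.
  by rewrite mulnn -!expnM; congr (l ^ _)%N; lia.
set L : R := ln n%:R; have L0 : 0 < L by rewrite ln_gt0 // ltr1n.
have nE : n%:R = expR L by rewrite lnK // posrE ltr0n.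
have X0 : (0 < X)%N by rewrite muln_gt0 expn_gt0; lia.
have lnX : ln X%:R * 4 <= L * 3.
  have : ln (X ^ 4)%:R <= ln (n ^ 3)%:R :> R.
    by rewrite ler_ln ?posrE ?ltr0n ?expn_gt0 ?X0 ?n0 // ler_nat.
  by rewrite !natrX !lnXn ?ltr0n // -!(mulr_natr (ln _)).
(* With n = exp (L / 8)^2 exp (3 L / 4), the first factor pays for the square of
   L and the second one for X. *)
have key : X%:R * L ^+ 2 <= 64 * n%:R.
  have h : L / 8 <= expR (L / 8) by have := expR_ge1Dx (L / 8); lra.
  have -> : n%:R = expR (L / 8) ^+ 2 * expR (L * 3 / 4) :> R.
    by rewrite nE expr2 -!expRD; congr expR; field.
  have hX : X%:R <= expR (L * 3 / 4).
    by rewrite -[X%:R]lnK ?posrE ?ltr0n // ler_expR; lra.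
  have h2 : L ^+ 2 <= 64 * expR (L / 8) ^+ 2.
    have -> : L ^+ 2 = 64 * (L / 8) ^+ 2 by field.
    by rewrite ler_wpM2l // lerXn2r // nnegrE ?expR_ge0 //; lra.
  rewrite mulrC mulrA; apply: ler_pM => //; first exact: sqr_ge0.
have lnN : ln ((n - m).+1 + l)%:R <= 2 * L.
  have -> : 2 * L = ln (n ^ 2)%:R by rewrite natrX lnXn ?ltr0n // mulr_natl.
  rewrite ler_ln ?posrE ?ltr0n ?expn_gt0 ?n0 // ler_nat; nia.
have N1 : n%:R <= 2 * (n - m).+1%:R :> R by rewrite -natrM ler_nat; lia.
have N0 : 0 < (n - m).+1%:R :> R by rewrite ltr0n.
rewrite ler_pdivrMr // mulrAC ler_pdivlMr //.
apply: (@le_trans _ _ (X%:R * (2 * L) * L)).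
  by rewrite ler_pM2r // ler_pM2l ?ltr0n.
nra.
Qed.

(** The first term uses n < l^(2(m+1)); the second one is O(1 / ln n), and
    ln k ln l >= (ln 2)^2. *)
Lemma risk_bound_le (R : realType) (k l n m : nat) : (1 < k)%N -> (1 < l)%N ->
  (l ^ 4 <= n)%N -> context_length n l = m ->
  ln k%:R / m.+1%:R + (l * l ^ m)%:R * ln ((n - m).+1 + l)%:R / (n - m).+1%:R <=
  (2 + 256 / ln 2 ^+ 2) * (ln k%:R * ln l%:R / ln n%:R) :> R.
Proof.
move=> k1 l1 l4 mE; have ln_n : (l <= n)%N.
  by apply: leq_trans l4; rewrite -{1}(expn1 l) leq_pexp2l //; lia.
have L0 : 0 < ln n%:R :> R by rewrite ln_gt0 // ltr1n; lia.
have ln20 : 0 < ln 2 :> R by rewrite ln_gt0 // ltr1n.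
have ln2_le (j : nat) : (1 < j)%N -> ln 2 <= ln j%:R :> R.
  by move=> j1; rewrite ler_ln ?posrE ?ltr0n ?ler_nat //; lia.
have lnk := ln2_le k k1; have lnl := ln2_le l l1.
have B1 : (1 < l * l)%N by nia.
have nB : (n < (l * l) ^ m.+1)%N by rewrite -mE trunc_log_ltn.
rewrite mulrDl; apply: lerD.
  rewrite ler_pdivrMr ?ltr0n //.
  have -> : 2 * (ln k%:R * ln l%:R / ln n%:R) * m.+1%:R =
      ln k%:R * (2 * ln l%:R * m.+1%:R / ln n%:R) :> R by ring.
  rewrite ler_peMr ?ler_pdivlMr ?mul1r //; first by lra.
  have : ln n%:R <= ln ((l * l) ^ m.+1)%:R :> R.
    by rewrite ler_ln ?posrE ?ltr0n ?expn_gt0 ?ler_nat //; lia.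
  rewrite natrX lnXn ?ltr0n; last by lia.
  rewrite natrM lnM ?posrE ?ltr0n; try lia.
  rewrite -[_ *+ m.+1]mulr_natr; lra.
apply: le_trans (sample_term_le R l1 l4 mE) _.
rewrite !mulrA ler_pM2r ?invr_gt0 // -mulrA mulrAC ler_pdivlMr ?exprn_gt0 //.
rewrite ler_pM2l ?expr2; [exact: ler_pM (ltW ln20) (ltW ln20) lnk lnl | lra].
Qed.

Theorem theorem2 (R : realType) (k l : nat -> nat)
    (hk : forall n, (2 <= k n)%N) (hl : forall n, (2 <= l n)%N)
    (hkl : (fun n : nat => ln (k n)%:R * ln (l n)%:R : R)
             =o_\oo (fun n : nat => ln n%:R : R)) :
  exists Q : forall n, n.-tuple 'I_(l n) -> 'I_(l n) -> R,
    [/\ forall n, is_estimator (Q n),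
        polytime_computable k Q
      & exists C : R, \forall n \near \oo,
          (risk (Q n) (@hmm_class R (k n) (l n) n)
             <= (C * (ln (k n)%:R * ln (l n)%:R / ln n%:R))%:E)%E].
Proof.
have ln20 : 0 < ln 2 :> R by rewrite ln_gt0 // ltr1n.
have l4 : \forall n \near \oo, (l n ^ 4 <= n)%N.
  have /eqoP /(_ (ln 2 / 4) _) := hkl.
  have e0 : 0 < ln 2 / 4 :> R by rewrite divr_gt0.
  move=> /(_ e0) H; near=> n.
  have n0 : (0 < n)%N by near: n; exact: nbhs_infty_gt.
  have : `|ln (k n)%:R * ln (l n)%:R| <= ln 2 / 4 * `|ln n%:R| :> R by near: n.
  have lnk : ln 2 <= ln (k n)%:R :> R by rewrite ler_ln ?posrE ?ltr0n ?ler_nat //; apply: leq_trans (hk n).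
  have lnl : ln 2 <= ln (l n)%:R :> R by rewrite ler_ln ?posrE ?ltr0n ?ler_nat //; apply: leq_trans (hl n).
  have lnn : 0 <= ln n%:R :> R by rewrite ln_ge0 // ler1n.
  rewrite (ger0_norm lnn) ger0_norm; last by apply: mulr_ge0; lra.
  (* The factor ln k n >= ln 2 cancels the one in the constant ln 2 / 4. *)
  move=> h; have h4 : 4 * ln (l n)%:R <= ln n%:R :> R by nra.
  rewrite -(ler_nat R) -ler_ln ?posrE ?ltr0n ?expn_gt0 //; last by rewrite (leq_trans _ (hl n)).
  by rewrite natrX lnXn ?ltr0n; [rewrite -[_ *+ 4]mulr_natl | apply: leq_trans (hl n)].
have [b lb] : exists b, forall n, (l n <= n + b)%N.
  have [n0 _ h] := l4; exists (\sum_(i < n0) l i)%N => n.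
  have [nn|nn] := leqP n0 n.
    apply: leq_trans (leq_addr _ _); apply: leq_trans (h n nn).
    by rewrite -{1}(expn1 (l n)) leq_pexp2l //; apply: leq_trans (hl n).
  by rewrite (bigD1 (Ordinal nn)) //= addnCA leq_addr.
exists (fun n => @predictor R (l n) n); split.
- by move=> n; exact: predictor_estimator.
- exact: polytime_predictor lb.
exists (2 + 256 / ln 2 ^+ 2); near=> n.
apply: le_trans (predictor_risk R _ (hl n) erefl) _; first exact: leq_trans (hk n).
rewrite lee_fin; apply: risk_bound_le => //; by near: n.
Unshelve. all: by end_near.
Qed.
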